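(* Let $R$ be a field and let $c\in M_n(R)$ be a Jordan-similar matrix of block type $\{(\lambda_{11},\lambda_{12},\dots,\lambda_{1s_1}),\dots,(\lambda_{t1},\lambda_{t2},\dots,\lambda_{ts_t})\}$. Let $S_n(c,R)=\{a\in M_n(R)\mid ac=ca\}$. Then (1) $S_n(c,R)$ has exactly $\sum_{i=1}^t s_i$ non-isomorphic simple modules. (2) The following are equivalent: (a) $S_n(c,R)$ is a quasi-hereditary algebra; (b) $\lambda_{ij}=s_i-j+1$ for all $1\le i\le t$, $1\le j\le s_i$; (c) $\lambda_{i1}=s_i$ for all $1\le i\le t$.
   Context: A Jordan block of size $m$ with eigenvalue $r\in R$ is the $m\times m$ matrix with $r$ on the main diagonal, $1$ on the superdiagonal, and $0$ elsewhere. A Jordan-block matrix is a block diagonal matrix whose diagonal blocks are Jordan blocks. A matrix $c\in M_n(R)$ is Jordan-similar if there is $u\in GL_n(R)$ such that $ucu^{-1}$ is a Jordan-block matrix. Block type: let $a$ be a Jordan-block matrix with $t$ distinct eigenvalues $r_1,\dots,r_t$; for each $i$, let $\lambda_{i1}>\lambda_{i2}>\cdots>\lambda_{is_i}$ be the distinct sizes of the Jordan blocks of $a$ with eigenvalue $r_i$ (each size may occur several times as a block of $a$, but is listed once). The block type of $a$ is $\{(\lambda_{11},\dots,\lambda_{1s_1}),\dots,(\lambda_{t1},\dots,\lambda_{ts_t})\}$ (one tuple for each eigenvalue). The block type of a Jordan-similar matrix $c$ is that of a Jordan-block matrix to which it is similar by a matrix in $GL_n(R)$. Quasi-hereditary algebra: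 for a finite-dimensional algebra $A$ over a field, an ideal $I$ is a heredity ideal if $I=AeA$ for some $e=e^2\in A$ with $e\,\mathrm{rad}(A)\,e=0$ and ${}_AAeA$ projective. $A$ is quasi-hereditary if there is a chain of ideals $0=I_0\subset I_1\subset\cdots\subset I_m=A$ such that $I_i/I_{i-1}$ is a heredity ideal of $A/I_{i-1}$ for each $i$. *)

(* Defs.v *)
From HB Require Import structures.
From mathcomp Require Import all_boot all_order all_algebra all_field.

Set Implicit Arguments.
Unset Strict Implicit.
Unset Printing Implicit Defensive.

Import GRing.Theory.
Local Open Scope ring_scope.

Section Modules.

Variable A : pzRingType.

Definition module_iso (M N : lmodType A) : Prop :=
  exists f : {linear M -> N}, bijective f.

Definition simple_module (M : lmodType A) : Prop :=
  (exists x : M, x != 0) /\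
  (forall S : {pred M}, submod_closed S -> S =i pred1 0 \/ S =i predT).

Definition projective_module (P : lmodType A) : Prop :=
  forall (M N : lmodType A) (g : {linear M -> N}) (f : {linear P -> N}),
    (forall y, exists x, g x = y) ->
    exists h : {linear P -> M}, forall x, g (h x) = f x.

Definition number_of_simple_modules (N : nat) : Prop :=
  exists S : 'I_N -> lmodType A,
    [/\ forall i, simple_module (S i),
        forall i j, module_iso (S i) (S j) -> i = j
      & forall M : lmodType A, simple_module M -> exists i, module_iso M (S i)].

End Modules.

(* Since a finite-dimensional F-algebra A contains the scalars, its ideals are
   F-subspaces, so they are taken in {vspace A}. *)
Section Ideals.

Variables (F : fieldType) (A : falgType F).

Definition left_ideal (I : {vspace A}) : bool := (fullv * I <= I)%VS.

Definition two_sided_ideal (I : {vspace A}) : bool :=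
  (fullv * I <= I)%VS && (I * fullv <= I)%VS.

Definition maximal_left_ideal (L : {vspace A}) : Prop :=
  [/\ left_ideal L, L != fullv
    & forall K : {vspace A}, left_ideal K -> (L <= K)%VS ->
        K = L \/ K = fullv].

Definition jacobson_radical (x : A) : Prop :=
  forall L : {vspace A}, maximal_left_ideal L -> x \in L.

Record proper_ideal := ProperIdeal {
  proper_ideal_space :> {vspace A};
  proper_idealP :
    two_sided_ideal proper_ideal_space && (proper_ideal_space != fullv) }.

End Ideals.

(* A left ideal of A as a left A-module; an alias of subvs_of L, which already
   carries a scalar multiplication by F. *)
Definition lideal_module (F : fieldType) (A : falgType F) (L : {vspace A})
  (hL : left_ideal L) : Type := subvs_of L.

Section LeftIdealModule.

Variables (F : fieldType) (A : falgType F) (L : {vspace A}).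
Hypothesis hL : left_ideal L.

HB.instance Definition _ :=
  GRing.Zmodule.copy (lideal_module hL) (subvs_of L).

Lemma lideal_memM (a : A) (u : subvs_of L) : a * vsval u \in L.
Proof. exact: subvP hL _ (memv_mul (memvf a) (subvsP u)). Qed.

Definition lideal_scale (a : A) (u : lideal_module hL) : lideal_module hL :=
  Subvs (lideal_memM a u).

Lemma lideal_scaleA a b u :
  lideal_scale a (lideal_scale b u) = lideal_scale (a * b) u.
Proof. by apply: val_inj; rewrite /= mulrA. Qed.

Lemma lideal_scale1 : left_id 1 lideal_scale.
Proof. by move=> u; apply: val_inj; rewrite /= mul1r. Qed.

Lemma lideal_scaleDr : right_distributive lideal_scale +%R.
Proof. by move=> a u v; apply: val_inj; rewrite /= mulrDr. Qed.

Lemma lideal_scaleDl u : {morph lideal_scale^~ u : a b / a + b}.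
Proof. by move=> a b; apply: val_inj; rewrite /= mulrDl. Qed.

HB.instance Definition _ := GRing.Zmodule_isLmodule.Build A (lideal_module hL)
  lideal_scaleA lideal_scale1 lideal_scaleDr lideal_scaleDl.

End LeftIdealModule.

Section Heredity.

Variables (F : fieldType) (A : falgType F).

Definition AeA (e : A) : {vspace A} := (fullv * <[e]> * fullv)%VS.

Lemma AeA_left_ideal (e : A) : left_ideal (AeA e).
Proof. by rewrite /left_ideal /AeA !prodvA prodvSl // prodvSl // subvf. Qed.

Definition heredity_ideal (I : {vspace A}) : Prop :=
  exists e : A,
    [/\ e * e = e,
        I = AeA e,
        forall x, jacobson_radical x -> e * x * e = 0
      & projective_module (lideal_module (AeA_left_ideal e) : lmodType A)].

End Heredity.

(* The quotient A / I, on the underlying space of the complement I^C : a class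
   is represented by its projection onto I^C along I. *)
Definition quot_alg (F : fieldType) (A : falgType F) (I : proper_ideal A) :
  Type := subvs_of (I^C)%VS.

Section QuotientAlgebra.

Variables (F : fieldType) (A : falgType F) (I : proper_ideal A).

HB.instance Definition _ :=
  Vector.copy (quot_alg I) (subvs_of (I^C)%VS).

Definition quot_pi : 'Hom(A, quot_alg I) :=
  linfun (vsproj (I^C)%VS \o daddv_pi (I^C)%VS I).

Definition quot_repr (x : quot_alg I) : A := vsval x.

Lemma compl_capv : (I^C :&: I = 0)%VS.
Proof. by rewrite capvC capv_compl. Qed.

Lemma quot_reprE x : quot_repr (quot_pi x) = daddv_pi (I^C)%VS I x.
Proof. by rewrite lfunE /= /quot_repr vsprojK ?memv_pi. Qed.

Lemma quot_reprK : cancel quot_repr quot_pi.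
Proof.
move=> x; apply: val_inj.
rewrite -[LHS]/(quot_repr _) quot_reprE daddv_pi_id ?compl_capv //.
exact: subvsP.
Qed.

Lemma quot_pi_surj (y : quot_alg I) : exists x, quot_pi x = y.
Proof. by exists (quot_repr y); exact: quot_reprK. Qed.

Lemma quot_pi_decomp x : x - quot_repr (quot_pi x) \in (I : {vspace A}).
Proof.
rewrite quot_reprE -{1}(daddv_pi_add compl_capv (w := x)).
  by rewrite addrAC subrr add0r memv_pi.
by rewrite addvC addv_complf memvf.
Qed.

Lemma quot_repr0 : quot_repr 0 = 0.
Proof. by []. Qed.

Lemma quot_pi_eq0 x : (quot_pi x == 0) = (x \in (I : {vspace A})).
Proof.
apply/eqP/idP => [x0 | Ix].
  by have := quot_pi_decomp x; rewrite x0 quot_repr0 subr0.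
rewrite -[LHS]quot_reprK; suff -> : quot_repr (quot_pi x) = 0 by rewrite linear0.
apply/eqP; rewrite -memv0 -compl_capv memv_cap.
rewrite {1}quot_reprE memv_pi /=.
by have := memvB Ix (quot_pi_decomp x); rewrite opprB addrC subrK.
Qed.

Lemma quot_pi_eq x y :
  (quot_pi x == quot_pi y) = (x - y \in (I : {vspace A})).
Proof. by rewrite -subr_eq0 -linearB quot_pi_eq0. Qed.

Lemma proper_ideal_mull a x :
  x \in (I : {vspace A}) -> a * x \in (I : {vspace A}).
Proof.
case/andP: (proper_idealP I) => /andP[lI _] _ Ix.
exact: subvP lI _ (memv_mul (memvf a) Ix).
Qed.

Lemma proper_ideal_mulr a x :
  x \in (I : {vspace A}) -> x * a \in (I : {vspace A}).
Proof.
case/andP: (proper_idealP I) => /andP[_ rI] _ Ix.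
exact: subvP rI _ (memv_mul Ix (memvf a)).
Qed.

Definition quot_one : quot_alg I := quot_pi 1.

Definition quot_mul (x y : quot_alg I) : quot_alg I :=
  quot_pi (quot_repr x * quot_repr y).

Lemma quot_pi_mul x y : quot_pi (x * y) = quot_mul (quot_pi x) (quot_pi y).
Proof.
apply/eqP; rewrite quot_pi_eq.
set x' := quot_repr _; set y' := quot_repr _.
have -> : x * y - x' * y' = (x - x') * y + x' * (y - y').
  by rewrite mulrBl mulrBr addrA subrK.
apply: memvD; [apply: proper_ideal_mulr | apply: proper_ideal_mull];
  exact: quot_pi_decomp.
Qed.

Lemma quot_mulA : associative quot_mul.
Proof.
move=> x y z; rewrite -(quot_reprK x) -(quot_reprK y) -(quot_reprK z).
by rewrite -!quot_pi_mul mulrA.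
Qed.

Lemma quot_mul1l : left_id quot_one quot_mul.
Proof. by move=> x; rewrite -(quot_reprK x) -quot_pi_mul mul1r. Qed.

Lemma quot_mul1r : right_id quot_one quot_mul.
Proof. by move=> x; rewrite -(quot_reprK x) -quot_pi_mul mulr1. Qed.

Lemma quot_mulDl : left_distributive quot_mul +%R.
Proof.
move=> x y z; rewrite -(quot_reprK x) -(quot_reprK y) -(quot_reprK z).
by rewrite -linearD -!quot_pi_mul mulrDl linearD.
Qed.

Lemma quot_mulDr : right_distributive quot_mul +%R.
Proof.
move=> x y z; rewrite -(quot_reprK x) -(quot_reprK y) -(quot_reprK z).
by rewrite -linearD -!quot_pi_mul mulrDr linearD.
Qed.

Lemma quot_one_neq0 : quot_one != 0.
Proof.
rewrite quot_pi_eq0; apply/negP => I1; case/andP: (proper_idealP I) => _ /negP.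
case; rewrite eqEsubv subvf /=; apply/subvP=> x _.
by rewrite -[x]mulr1 proper_ideal_mull.
Qed.

HB.instance Definition _ := GRing.Zmodule_isNzRing.Build (quot_alg I)
  quot_mulA quot_mul1l quot_mul1r quot_mulDl quot_mulDr quot_one_neq0.

Lemma quot_piM x y : quot_pi (x * y) = quot_pi x * quot_pi y.
Proof. exact: quot_pi_mul. Qed.

Lemma quot_scaleAl (a : F) (x y : quot_alg I) : a *: (x * y) = (a *: x) * y.
Proof.
rewrite -(quot_reprK x) -(quot_reprK y) -quot_piM -!linearZ /= -quot_piM.
by rewrite scalerAl.
Qed.

HB.instance Definition _ :=
  GRing.Lmodule_isLalgebra.Build F (quot_alg I) quot_scaleAl.

Lemma quot_scaleAr (a : F) (x y : quot_alg I) : a *: (x * y) = x * (a *: y).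
Proof.
rewrite -(quot_reprK x) -(quot_reprK y) -quot_piM -!linearZ /= -quot_piM.
by rewrite scalerAr.
Qed.

HB.instance Definition _ :=
  GRing.Lalgebra_isAlgebra.Build F (quot_alg I) quot_scaleAr.

HB.instance Definition _ := Algebra_isFalgebra.Build F (quot_alg I).

Lemma quot_pi1 : quot_pi 1 = 1.
Proof. by []. Qed.

End QuotientAlgebra.

Definition quasi_hereditary (F : fieldType) (A : falgType F) : Prop :=
  exists (m : nat) (I : nat -> {vspace A}),
    [/\ I 0%N = 0%VS,
        I m = fullv,
        forall i, (i <= m)%N -> two_sided_ideal (I i),
        forall i, (i < m)%N -> (I i <= I i.+1)%VS && (I i != I i.+1)
      & forall i, (i < m)%N ->
          exists2 J : proper_ideal A, J = I i :> {vspace A}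
            & heredity_ideal (quot_pi J @: I i.+1)%VS].

Section Jordan.

Variable R : fieldType.

Definition jordan_block (m : nat) (r : R) : 'M[R]_m :=
  \matrix_(i, j) if i == j then r else if j == i.+1 :> nat then 1 else 0.

(* A pair (r, m) in bs stands for a Jordan block of size m and eigenvalue r. *)
Definition is_jordan_block_matrix (n : nat) (a : 'M[R]_n)
  (bs : seq (R * nat)) : Prop :=
  all (fun b => 0 < b.2)%N bs /\
  exists e : (\sum_(i < size bs) (tnth (in_tuple bs) i).2)%N = n,
    a = castmx (e, e) (\mxdiag_(i < size bs)
          jordan_block (tnth (in_tuple bs) i).2 (tnth (in_tuple bs) i).1).

Definition jordan_eigenvalues (bs : seq (R * nat)) : seq R :=
  undup [seq b.1 | b <- bs].

Definition jordan_sizes (bs : seq (R * nat)) (r : R) : seq nat :=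
  sort geq (undup [seq b.2 | b <- bs & b.1 == r]).

Definition block_type (bs : seq (R * nat)) : seq (seq nat) :=
  [seq jordan_sizes bs r | r <- jordan_eigenvalues bs].

(* The order in which the eigenvalues are listed is irrelevant, but the
   multiplicity is not: distinct eigenvalues may have the same tuple of sizes. *)
Definition jordan_similar_of_type (n : nat) (c : 'M[R]_n)
  (lam : seq (seq nat)) : Prop :=
  exists (bs : seq (R * nat)) (u : 'M[R]_n),
    [/\ u \in unitmx,
        is_jordan_block_matrix (u *m c *m invmx u) bs
      & perm_eq lam (block_type bs)].

(* The elements of 'C[c] are the a with a * c = c * a (cent1vP). *)
Definition centralizer_alg (n : nat) (c : 'M[R]_n.+1) : falgType R :=
  subvs_of 'C[c]%AS.

End Jordan.

(* Main.v *)
From HB Require Import structures.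
Require Import Defs.
From mathcomp Require Import all_boot all_order all_algebra all_field.
From mathcomp Require Import boolp zify.
(* [ring_quotient] also has a [proper_ideal]. *)
Import Defs.

Set Implicit Arguments.
Unset Strict Implicit.
Unset Printing Implicit Defensive.

Import GRing.Theory.
Local Open Scope ring_scope.

(* In Jordan coordinates an element of the centralizer of c is a matrix of
   homomorphisms R[x]/(x^m_k) -> R[x]/(x^m_l) between blocks k, l with the same
   eigenvalue.  Such a homomorphism is multiplication by a polynomial of degree
   < m_l divisible by x^(m_l - m_k), so the T k l d, "multiplication by x^d
   from block k to block l", form a basis with
   T k l d * T l p d' = T k p (d+d').

   The degree 2d + m_k - m_l is additive and nonnegative, and it vanishes
   exactly when d = 0 and m_k = m_l; the degree-0 part is a product of matrix
   algebras, one for each pair (eigenvalue, size).  In a simple module a nonzero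
   vector T k l d y0 of maximal degree is killed by all elements of positive
   degree, which determines the module.

   For an idempotent e with e rad(A) e = 0, the central nilpotent X = sum_k
   T k k 1 satisfies X e = 0, so e lies in the annihilator of X, spanned by the
   T k l (m_l - 1).  Expanding e = e^2 then shows that AeA is the part of this
   annihilator supported on some eigenvalues, each of which has a block of
   size 1.  The quotient by AeA is an algebra of the same shape in which all
   blocks of these eigenvalues have lost 1 from their size.  Hence along a
   heredity chain the sizes of every eigenvalue must run through 1, 2, ...
   without gap.  Conversely, for sizes without gap the annihilators of the
   powers of X form a heredity chain. *)

(** * Algebras with a basis of truncated matrix units *)

Section BlockAlgebra.

Variables (F : fieldType) (K : eqType) (I : finType).

Definition block_valid (r : I -> K) (m : I -> nat) (k l : I) (d : nat) : bool :=
  (r k == r l) && (m l - m k <= d < m l)%N.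

(* [cf k l d a] is the coefficient of [T k l d] in [a].  The [m k] may be 0, so
   that quotients by heredity ideals are again of this form on the same [I]. *)
Record block_algebra (A : falgType F) (r : I -> K) (m : I -> nat)
  (cf : I -> I -> nat -> A -> F) (T : I -> I -> nat -> A) : Prop :=
    BlockAlgebra {
  cf_linear : forall k l d z a b,
    cf k l d (z *: a + b) = z * cf k l d a + cf k l d b;
  cf_invalid : forall k l d a, ~~ block_valid r m k l d -> cf k l d a = 0;
  cf_one : forall k l d,
    cf k l d 1 = (block_valid r m k l d && ((l == k) && (d == 0%N)))%:R;
  cf_mul : forall k p d a b, (d < m p)%N ->
    cf k p d (a * b) =
      \sum_l \sum_(i < d.+1) cf k l i a * cf l p (d - i)%N b;
  cf_eq0 : forall a, (forall k l d, cf k l d a = 0) -> a = 0;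
  cf_basis : forall k l d k' l' d', cf k' l' d' (T k l d) =
    (block_valid r m k l d && [&& k' == k, l' == l & d' == d])%:R }.

Section Theory.

Variables (A : falgType F) (r : I -> K) (m : I -> nat).
Variables (cf : I -> I -> nat -> A -> F) (T : I -> I -> nat -> A).
Hypothesis bA : block_algebra r m cf T.

Local Notation valid := (block_valid r m).

Lemma cf0 k l d : cf k l d 0 = 0.
Proof. by have := cf_linear bA k l d (-1) 0 0;
  rewrite scaler0 addr0 mulN1r addNr. Qed.

Lemma cfD k l d a b : cf k l d (a + b) = cf k l d a + cf k l d b.
Proof. by have := cf_linear bA k l d 1 a b; rewrite scale1r mul1r. Qed.

Lemma cfZ k l d z a : cf k l d (z *: a) = z * cf k l d a.
Proof. by have := cf_linear bA k l d z a 0; rewrite cf0 !addr0. Qed.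

Lemma cfB k l d a b : cf k l d (a - b) = cf k l d a - cf k l d b.
Proof. by rewrite addrC -scaleN1r (cf_linear bA) mulN1r addrC. Qed.

Lemma cf_sum k l d (J : Type) (s : seq J) (P : pred J) (a : J -> A) :
  cf k l d (\sum_(i <- s | P i) a i) = \sum_(i <- s | P i) cf k l d (a i).
Proof. exact: (big_morph _ (cfD k l d) (cf0 k l d)). Qed.

Lemma cf_inj a b : (forall k l d, valid k l d -> cf k l d a = cf k l d b) -> a
  = b.
Proof.
move=> ab; apply/eqP; rewrite -subr_eq0; apply/eqP/(cf_eq0 bA) => k l d.
rewrite cfB; have [v|nv] := boolP (valid k l d); first by rewrite ab // subrr.
by rewrite !(cf_invalid bA _ nv) subrr.
Qed.

Lemma basis_invalid k l d : ~~ valid k l d -> T k l d = 0.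
Proof.
by move=> nv; apply: cf_inj => k' l' d' _;
  rewrite (cf_basis bA) (negbTE nv) cf0.
Qed.

Lemma basis_big k l d : (m l <= d)%N -> T k l d = 0.
Proof. by move=> h; apply: basis_invalid; rewrite /block_valid; lia. Qed.

Lemma cf_mul_basisl k l d b k' p n : (n < m p)%N ->
  cf k' p n (T k l d * b) =
  if [&& valid k l d, k' == k & (d <= n)%N] then cf l p (n - d)%N b else 0.
Proof.
move=> lt_n; rewrite (cf_mul bA) //.
under eq_bigr => l0 _ do under eq_bigr => i _ do rewrite (cf_basis bA).
case: (boolP (valid k l d)) => [v|nv] /=; last first.
  by rewrite big1 // => l0 _; rewrite big1 // => i _; rewrite mul0r.
case: (eqVneq k' k) => [_|_] /=; last first.
  by rewrite big1 // => l0 _; rewrite big1 // => i _; rewrite mul0r.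
rewrite (bigD1 l) //= [X in _ + X]big1 ?addr0; last first.
  move=> l0 /negPf nl; rewrite big1 // => i _; rewrite nl mul0r //.
case: leqP => [le_d|lt_d].
  rewrite (bigD1 (Ordinal (le_d : d < n.+1)%N)) //= !eqxx mul1r.
  rewrite big1 ?addr0 // => i; rewrite -val_eqE /= => /negPf ->.
  by rewrite mul0r.
rewrite big1 // => i _; rewrite eqxx /=; case: eqP => [e|_];
  last by rewrite mul0r.
by have := ltn_ord i; lia.
Qed.

Lemma cf_mul_basisr k l d a k' p n : (n < m p)%N ->
  cf k' p n (a * T k l d) =
  if [&& valid k l d, p == l & (d <= n)%N] then cf k' k (n - d)%N a else 0.
Proof.
move=> lt_n; rewrite (cf_mul bA) //.
under eq_bigr => l0 _ do under eq_bigr => i _ do rewrite (cf_basis bA).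
case: (boolP (valid k l d)) => [v|nv] /=; last first.
  by rewrite big1 // => l0 _; rewrite big1 // => i _; rewrite mulr0.
case: (eqVneq p l) => [_|_] /=; last first.
  by rewrite big1 // => l0 _; rewrite big1 // => i _; rewrite andbF mulr0.
rewrite (bigD1 k) //= [X in _ + X]big1 ?addr0; last first.
  move=> l0 /negPf nl; rewrite big1 // => i _; rewrite nl mulr0 //.
rewrite eqxx /=; case: leqP => [le_d|lt_d].
  have h : (n - d < n.+1)%N by lia.
  rewrite (bigD1 (Ordinal h)) //= subKn // eqxx mulr1.
  rewrite big1 ?addr0 // => i; rewrite -val_eqE /= => ni.
  by have := ltn_ord i; case: eqP => [e|_]; rewrite ?mulr0 //; lia.
rewrite big1 // => i _; case: eqP => [e|_]; last by rewrite mulr0.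
by have := ltn_ord i; lia.
Qed.

(** This covers vanishing factors too: if [d >= m l], then [d + d' >= m l + (m p - m l) >= m p], so
    both sides are zero; likewise if [d' >= m p]. *)
Lemma basis_mul k l d p d' : r k = r l -> (m l - m k <= d)%N ->
  r l = r p -> (m p - m l <= d')%N -> T k l d * T l p d' = T k p (d + d')%N.
Proof.
move=> rkl dl rlp dp; apply: cf_inj => k0 p0 n /andP[_ /andP[_ lt_n]].
rewrite cf_mul_basisl // !(cf_basis bA) /block_valid rkl rlp !eqxx /=.
have [_|_] := eqVneq k0 k; last by rewrite !andbF.
have [e|_] := eqVneq p0 p; last by rewrite /= !andbF; case: ifP.
by rewrite e in lt_n; rewrite /=; case: ifP => h;
  do 2?[congr (_%:R)|rewrite -[0]/(0%:R)]; lia.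
Qed.

Lemma basis_mul0 k l l' d p d' : l != l' -> T k l d * T l' p d' = 0.
Proof.
move=> nl; apply: cf_inj => k0 p0 n /andP[_ /andP[_ lt_n]].
by rewrite cf0 cf_mul_basisl // (cf_basis bA) (negPf nl) !andbF; case: ifP.
Qed.

Lemma basis_idl k l d : T k k 0 * T k l d = T k l d.
Proof.
have [|nv] := boolP (valid k l d); last by rewrite (basis_invalid nv) mulr0.
by case/andP=> /eqP e /andP[? ?]; rewrite basis_mul //; lia.
Qed.

Lemma basis_idr k l d : T k l d * T l l 0 = T k l d.
Proof.
have [|nv] := boolP (valid k l d); last by rewrite (basis_invalid nv) mul0r.
by case/andP=> /eqP e /andP[? ?]; rewrite basis_mul ?addn0 //; lia.
Qed.

Lemma basis_sum1 : 1 = \sum_k T k k 0.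
Proof.
apply: cf_inj => k l d v; rewrite (cf_one bA) cf_sum.
rewrite v /= (bigD1 k) //= big1 ?addr0; last first.
  by move=> k' nk; rewrite (cf_basis bA) [k == _]eq_sym (negPf nk) /= andbF.
rewrite (cf_basis bA) eqxx; have [e|_] := eqVneq l k; last by rewrite !andbF.
case: (eqVneq d 0%N) => [ed|]; rewrite ?andbF //= andbT.
by rewrite e ed in v; rewrite v.
Qed.

Lemma basis_expand a :
  a = \sum_k \sum_l \sum_(d < m l) cf k l d a *: T k l d.
Proof.
apply: cf_inj => k l d v;
  rewrite cf_sum (bigD1 k) //= [X in _ + X]big1 ?addr0; last first.
  move=> k' nk; rewrite cf_sum big1 // => l' _; rewrite cf_sum big1 // => d' _.
  by rewrite cfZ (cf_basis bA) [k == _]eq_sym (negPf nk) andbF mulr0.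
rewrite cf_sum (bigD1 l) //= [X in _ + X]big1 ?addr0; last first.
  move=> l' nl; rewrite cf_sum big1 // => d' _.
  by rewrite cfZ (cf_basis bA) [l == _]eq_sym (negPf nl) !andbF mulr0.
have /andP[_ /andP[_ lt_d]] := v.
rewrite cf_sum (bigD1 (Ordinal lt_d)) //= [X in _ + X]big1 ?addr0; last first.
  move=> d'; rewrite -val_eqE /= => nd.
  by rewrite cfZ (cf_basis bA) [d == _]eq_sym (negPf nd) !andbF mulr0.
by rewrite cfZ (cf_basis bA) v !eqxx mulr1.
Qed.

End Theory.
End BlockAlgebra.

(** * Simple modules *)

(** The column module of the matrix algebra that the class [q] contributes to the degree-0 part. The
    type carries [bA] and [m_gt0] because the module laws proved below rest on them. *)
Definition block_simple (F : fieldType) (K : eqType) (I : finType)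
  (A : falgType F) (r : I -> K) (m : I -> nat) (cf : I -> I -> nat -> A -> F)
  (T : I -> I -> nat -> A) (bA : block_algebra r m cf T)
  (m_gt0 : forall k, (0 < m k)%N) (q : K * nat) : Type :=
  {ffun {k : I | (r k, m k) == q} -> F}.

Lemma module_iso_sym (A : pzRingType) (M N : lmodType A) :
  module_iso M N -> module_iso N M.
Proof.
case=> f [g fK gK]; have glin : linear g.
  by move=> a u v; apply: (can_inj fK); rewrite linearP !gK.
pose gl : {linear N -> M} := HB.pack g (GRing.isLinear.Build A N M _ g glin).
by exists gl, f.
Qed.

Section SimpleModules.

Variables (F : fieldType) (K : eqType) (I : finType).
Variables (A : falgType F) (r : I -> K) (m : I -> nat).
Variables (cf : I -> I -> nat -> A -> F) (T : I -> I -> nat -> A).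
Hypothesis bA : block_algebra r m cf T.
Hypothesis m_gt0 : forall k, (0 < m k)%N.

Local Notation valid := (block_valid r m).

Section Module.

Variable q : K * nat.

Local Notation S := (block_simple bA m_gt0 q).

HB.instance Definition _ := GRing.Zmodule.copy S
  {ffun {k : I | (r k, m k) == q} -> F}.

Lemma block_class_r (k : {k : I | (r k, m k) == q}) : r (val k) = q.1.
Proof. by case: k => k /= /eqP <-. Qed.

Lemma block_class_m (k : {k : I | (r k, m k) == q}) : m (val k) = q.2.
Proof. by case: k => k /= /eqP <-. Qed.

Definition block_simple_scale (a : A) (v : S) : S :=
  [ffun k => \sum_l cf (val k) (val l) 0 a * v l].

(** An index [l] between [k] and [p] contributes to the degree-0 coefficient only if
    [m k >= m l >= m p]. Since [m k = m p], such an [l] lies in the class [q], so the sum over all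
    blocks reduces to one over the class. *)
Lemma block_simple_scaleA a b v :
  block_simple_scale a (block_simple_scale b v) = block_simple_scale (a * b) v.
Proof.
apply/ffunP => k; rewrite !ffunE.
under eq_bigr => l _ do rewrite ffunE mulr_sumr.
rewrite exchange_big /=; apply: eq_bigr => p _.
rewrite (cf_mul bA (val k) a b (m_gt0 (val p)));
  under [in RHS]eq_bigr => l _ do rewrite big_ord1 /=.
rewrite mulr_suml; under eq_bigr => l _ do rewrite mulrA.
pose f l := cf (val k) l 0 a * cf l (val p) 0 b * v p.
rewrite -(big_sub [pred l | (r l, m l) == q] f) /=.
rewrite big_mkcond /=; apply: eq_bigr => l _; rewrite inE.
case: eqP => // nq.
have [/andP[/eqP rkl /andP[mlk _]]|nv] := boolP (valid (val k) l 0); last first.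
  by rewrite (cf_invalid bA) // !mul0r.
have [/andP[/eqP rlp /andP[mpl _]]|nv] := boolP (valid l (val p) 0); last first.
  by rewrite [X in _ * X * _](cf_invalid bA) // mulr0 mul0r.
rewrite block_class_m in mlk; rewrite block_class_m in mpl.
case: nq; rewrite [RHS]surjective_pairing -rkl block_class_r; congr (_, _).
by lia.
Qed.

Lemma block_simple_scale1 : left_id 1 block_simple_scale.
Proof.
move=> v; apply/ffunP => k; rewrite !ffunE (bigD1 k) //= big1 ?addr0.
  by rewrite (cf_one bA) !eqxx /block_valid eqxx subnn m_gt0 mul1r.
by move=> l; rewrite -val_eqE /= (cf_one bA) => /negPf->; rewrite andbF mul0r.
Qed.

Lemma block_simple_scaleDr : right_distributive block_simple_scale +%R.
Proof.
move=> a u v; apply/ffunP => k; rewrite !ffunE -big_split /=.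
by apply: eq_bigr => l _; rewrite ffunE mulrDr.
Qed.

Lemma block_simple_scaleDl v : {morph block_simple_scale^~ v : a b / a + b}.
Proof.
move=> a b; apply/ffunP => k; rewrite !ffunE -big_split /=.
by apply: eq_bigr => l _; rewrite (cfD bA) mulrDl.
Qed.

HB.instance Definition _ := GRing.Zmodule_isLmodule.Build A S
  block_simple_scaleA block_simple_scale1 block_simple_scaleDr
  block_simple_scaleDl.

Lemma block_simple_scaleE (a : A) (v : S) k :
  (a *: v) k = \sum_l cf (val k) (val l) 0 a * v l.
Proof. by rewrite ffunE. Qed.

Lemma block_simple_basis z k l (v : S) :
  (z *: T (val k) (val l) 0) *: v = [ffun k' => if k' == k then z * v l else 0].
Proof.
apply/ffunP => k'; rewrite block_simple_scaleE ffunE (bigD1 l) //= big1 ?addr0.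
  rewrite (cfZ bA) (cf_basis bA) /block_valid val_eqE.
  rewrite m_gt0 !block_class_r !block_class_m subnn !eqxx andbT /=.
  by case: ifP; rewrite (mulr1, mulr0) ?mul0r.
move=> l'; rewrite -val_eqE /= (cfZ bA) (cf_basis bA) => /negPf ->.
by rewrite !andbF mulr0 mul0r.
Qed.

End Module.

Local Notation S := (block_simple bA m_gt0).

(** Any vector with a non-zero coordinate [l] generates: [T k l 0] moves that coordinate to an
    arbitrary position [k] of the class. *)
Lemma block_simpleP k0 : simple_module (S (r k0, m k0) : lmodType A).
Proof.
pose i0 : {k | (r k, m k) == (r k0, m k0)} := exist _ k0 (eqxx _).
split.
  exists ([ffun=> 1] : S (r k0, m k0)); apply/eqP => /ffunP/(_ i0).
  by rewrite !ffunE => /eqP; rewrite oner_eq0.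
move=> P [P0 Plin].
have [[v [Pv /eqP v0]]|nex] := pselect (exists v : S _, v \in P /\ v != 0);
  last first.
  left=> v; rewrite inE; apply/idP/eqP => [Pv|-> //].
  by apply: contrapT => v0; case: nex; exists v; split=> //; apply/eqP.
right=> u; rewrite inE.
have [l vl] : exists l, v l != 0.
  apply: contrapT => nex; case: v0; apply/ffunP => l; rewrite ffunE.
  by apply: contrapT => vl; case: nex; exists l; apply/eqP.
have -> : u = \sum_k ((u k / v l) *: T (val k) (val l) 0) *: v.
  apply/ffunP => k; rewrite sum_ffunE (bigD1 k) //= big1 ?addr0.
    by rewrite block_simple_basis ffunE eqxx divfK.
  by move=> k' nk; rewrite block_simple_basis ffunE eq_sym (negPf nk).
apply: (big_ind (fun x => x \in P)) => // [x y Px Py|k _].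
  by have := Plin 1 x y Px Py; rewrite scale1r.
by have := Plin ((u k / v l) *: T (val k) (val l) 0) v 0 Pv P0; rewrite addr0.
Qed.

(** The idempotent [T k k 0] acts non-trivially on the module of the class of [k] and by zero on the
    modules of all other classes. *)
Lemma block_simple_iso k q' :
  module_iso (S (r k, m k) : lmodType A) (S q' : lmodType A) -> (r k, m k) = q'.
Proof.
case=> f /bij_inj f_inj; apply/eqP/negPn/negP => nq.
pose i0 : {k' | (r k', m k') == (r k, m k)} := exist _ k (eqxx _).
pose v1 : S (r k, m k) := [ffun=> 1].
have /f_inj/ffunP/(_ i0) : f (T k k 0 *: v1) = f 0.
  rewrite linearZ linear0; apply/ffunP => p;
    rewrite block_simple_scaleE big1 ?ffunE //.
  move=> l _; rewrite (cf_basis bA); case: eqP => [e|_];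
    last by rewrite !andbF mul0r.
  by case/eqP: nq; rewrite -e; have := valP p => /eqP.
rewrite -[T k k 0]scale1r (block_simple_basis 1 i0 i0) !ffunE eqxx mul1r =>
  /eqP.
by rewrite oner_eq0.
Qed.

(** * Simple modules generated by a vector of top degree *)

Section Classification.

Variables (M : lmodType A) (y : M) (k : I).
Hypothesis y_neq0 : y != 0.
Hypothesis y_idem : T k k 0 *: y = y.
Hypothesis y_killed : forall j d,
  T j k d *: y != 0 -> d = 0%N /\ (r j, m j) = (r k, m k).

(** By [y_idem], only basis elements starting with [T j k] can act non-trivially on [y]; by
    [y_killed], only those with [d = 0] and [j] in the class of [k] do. *)
Lemma scale_top_vector (b : A) :
  b *: y = \sum_(i : {j | (r j, m j) == (r k, m k)})
             (cf (val i) k 0 b *: T (val i) k 0) *: y.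
Proof.
rewrite {1}(basis_expand bA b) scaler_suml.
rewrite -(big_sub [pred j | (r j, m j) == (r k, m k)]
  (fun j => (cf j k 0 b *: T j k 0) *: y)) [RHS]big_mkcond /=.
have scale0 (z : F) (a : A) : a *: y = 0 -> (z *: a) *: y = 0.
  by move=> ay0; rewrite -[a]mul1r scalerAl -scalerA ay0 scaler0.
apply: eq_bigr => j _;
  rewrite scaler_suml (bigD1 k) //= [X in _ + X]big1 ?addr0.
  rewrite inE scaler_suml (bigD1 (Ordinal (m_gt0 k))) //= big1 ?addr0.
    case: eqP => // nq; apply: scale0; apply/eqP/negPn/negP => /y_killed[_].
    by move/eqP; rewrite (introF eqP nq).
  move=> d nd; apply: scale0; apply/eqP/negPn/negP => /y_killed[d0 _].
  by move: nd; rewrite -val_eqE /= d0.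
move=> l nl; rewrite scaler_suml big1 // => d _; apply: scale0.
by rewrite -y_idem scalerA (basis_mul0 bA) // scale0r.
Qed.

Definition simple_to_module (v : S (r k, m k)) : M :=
  \sum_i (v i *: T (val i) k 0) *: y.

Lemma simple_to_module_linear : linear simple_to_module.
Proof.
move=> a u v; rewrite /simple_to_module scaler_sumr.
have -> : \sum_i ((a *: u + v) i *: T (val i) k 0) *: y =
    \sum_i ((a *: u) i *: T (val i) k 0) *: y + \sum_i (v i *: T (val i) k 0)
      *: y.
  by rewrite -big_split; apply: eq_bigr => i _; rewrite ffunE !scalerDl.
congr (_ + _); transitivity (\sum_(l : {j | (r j, m j) == (r k, m k)})
  \sum_(i : {j | (r j, m j) == (r k, m k)})
  (cf (val i) (val l) 0 a * u l) *: T (val i) k 0 *: y).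
  rewrite exchange_big /=; apply: eq_bigr => i _.
  by rewrite block_simple_scaleE !scaler_suml.
apply: eq_bigr => l _.
rewrite scalerA scale_top_vector; apply: eq_bigr => i _.
congr (_ *: _ *: _); rewrite -scalerAr (cfZ bA) (cf_mul_basisr bA) ?m_gt0 //.
have rl := block_class_r l; have ml := block_class_m l.
by rewrite /block_valid rl ml !eqxx !subnn /= m_gt0 mulrC.
Qed.

(** Acting with [T k l 0] on the image of [v] isolates one coordinate: the result is [v l] times
    [y]. *)
Lemma simple_to_module_inj : injective simple_to_module.
Proof.
have lin0 : simple_to_module 0 = 0.
  by rewrite /simple_to_module big1 // => i _; rewrite ffunE !scale0r.
have inj0 v : simple_to_module v = 0 -> v = 0.
  move=> fv0; apply/ffunP => l; rewrite [RHS]ffunE.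
  have : T k (val l) 0 *: simple_to_module v = 0 by rewrite fv0 scaler0.
  have rl := block_class_r l; have ml := block_class_m l.
  rewrite scaler_sumr (bigD1 l) //= big1 ?addr0.
    rewrite scalerA -scalerAr (basis_mul bA) ?rl ?ml ?subnn // => vy.
    apply: contrapT => /eqP vl; case/eqP: y_neq0; rewrite -y_idem.
    rewrite -[T k k 0]scale1r -(mulVf vl) -scalerA -[_ *: T k k 0]mul1r.
    by rewrite scalerAl -scalerA vy scaler0.
  move=> i ni; rewrite scalerA -scalerAr (basis_mul0 bA) ?scaler0 ?scale0r //.
  by rewrite eq_sym.
move=> u v fuv; apply/eqP; rewrite -subr_eq0; apply/eqP/inj0.
rewrite -scaleN1r addrC simple_to_module_linear fuv.
by rewrite scaleN1r addNr.
Qed.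

Lemma simple_to_module_iso : simple_module M ->
  module_iso (S (r k, m k) : lmodType A) M.
Proof.
move=> [_ simM].
pose f : {linear S (r k, m k) -> M} := HB.pack simple_to_module
  (GRing.isLinear.Build A _ M _ simple_to_module simple_to_module_linear).
(* The submodule generated by [y] is non-zero, hence all of [M], and [scale_top_vector] puts each of
   its elements in the image of [f]. *)
pose P : {pred M} := fun x => `[< exists b, x = b *: y >].
have Pclosed : submod_closed P.
  split=> [|a u v]; first by apply/asboolP; exists 0; rewrite scale0r.
  move=> /asboolP[b ->] /asboolP[c ->]; apply/asboolP; exists (a * b + c).
  by rewrite scalerDl scalerA.
have Py : y \in P by apply/asboolP; exists 1; rewrite scale1r.
have fsurj x : exists v, f v == x.
  case: (simM P Pclosed) => [/(_ y)|/(_ x)].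
    by rewrite Py inE (negPf y_neq0).
  rewrite inE => /asboolP[b ->]; rewrite scale_top_vector.
  exists [ffun i => cf (val i) k 0 b]; apply/eqP/eq_bigr => i _.
  by rewrite ffunE.
exists f, (fun x => xchoose (fsurj x)) => [v|x];
  last exact/eqP/(xchooseP (fsurj x)).
exact/simple_to_module_inj/eqP/(xchooseP (fsurj (f v))).
Qed.

End Classification.

Lemma simple_module_class (M : lmodType A) : simple_module M ->
  exists k, module_iso (S (r k, m k) : lmodType A) M.
Proof.
move=> simM; have [[x /eqP x0] _] := simM.
have [k0 k0x] : exists k, T k k 0 *: x != 0.
  apply: contrapT => nex; case: x0.
  rewrite -[x]scale1r (basis_sum1 bA) scaler_suml big1 // => k _.
  by apply: contrapT => /eqP kx; case: nex; exists k.
(* [B] bounds every exponent of a non-zero basis element, so the maximum of the degree is taken over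
   a finite type. *)
pose B := (\max_k m k).+1.
have ltB k d : (d < m k)%N -> (d < B)%N.
  by move=> lt_d; apply: leq_trans lt_d _; apply: leqW; exact: leq_bigmax.
pose t0 : I * I * 'I_B := (k0, k0, ord0).
pose nz (t : I * I * 'I_B) := T t.1.1 t.1.2 t.2 *: x != 0.
(* This is [2d + m k - m l]; the subtraction is exact for valid triples, since there
   [m l <= d + m k]. *)
pose deg (t : I * I * 'I_B) := (t.2 + (t.2 + m t.1.1 - m t.1.2))%N.
have nz0 : nz t0 by [].
case: (@arg_maxnP _ t0 nz deg nz0) => -[[k l] d] /=; rewrite /nz /= => y0 ymax.
have vkl : valid k l d.
  by apply: contrapT => /negP nv;
    rewrite (basis_invalid bA nv) scale0r eqxx in y0.
have /andP[/eqP rkl /andP[d1 d2]] := vkl.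
exists k; apply: simple_to_module_iso y0 _ _ simM.
  by rewrite scalerA (basis_idl bA).
(* The product is [T j l (d' + d)], so maximality gives [2d' + m j - m k <= 0]. Validity gives
   [d' >= m k - m j], which leaves [d' = 0] and [m j = m k]. *)
move=> j d'; rewrite scalerA => nzj.
have vjk : valid j k d'.
  apply: contrapT => /negP nv.
  by rewrite (basis_invalid bA nv) mul0r scale0r eqxx in nzj.
have /andP[/eqP rjk /andP[d1' d2']] := vjk.
rewrite (basis_mul bA) // in nzj.
have lt_d : (d' + d < m l)%N.
  by rewrite ltnNge; apply/negP => le_d;
    rewrite (basis_big bA _ le_d) scale0r eqxx in nzj.
have := ymax (j, l, Ordinal (ltB _ _ lt_d)) nzj; rewrite /deg /=.
by move=> /= le_deg; split; [lia | rewrite rjk; congr (_, _); lia].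
Qed.

Theorem block_number_of_simple_modules :
  number_of_simple_modules A (size (undup [seq (r k, m k) | k : I])).
Proof.
set s := undup _; exists (fun i => S (tnth (in_tuple s) i)).
have mem_s i : exists k, tnth (in_tuple s) i = (r k, m k).
  have : tnth (in_tuple s) i \in s by exact: mem_tnth.
  by rewrite mem_undup => /mapP[k _ ->]; exists k.
split=> [i|i j|M simM].
- by have [k ->] := mem_s i; exact: block_simpleP.
- have [k Ek] := mem_s i; rewrite Ek => /block_simple_iso; rewrite -Ek.
  move=> eij; apply/val_inj/eqP.
  rewrite -(nth_uniq (tnth (in_tuple s) i) (ltn_ord i) (ltn_ord j) (undup_uniq
    _)).
  by rewrite -!(tnth_nth _ (in_tuple s)) eij.
have [k kM] := simple_module_class simM.
have ks : (r k, m k) \in s by rewrite mem_undup map_f ?mem_enum.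
have /tnthP[i Ei] : (r k, m k) \in in_tuple s by []. exists i; rewrite -Ei.
exact: module_iso_sym.
Qed.

End SimpleModules.

(** * Ideals, quotients and heredity ideals *)

(** If a maximal left ideal [L] misses [x], then [L + A x = A], so [1 - b x] lies in [L] for some
    [b]. As [x] is central, [b x] is nilpotent and the geometric sum inverts [1 - b x], which puts 1
    in [L]. *)
Lemma central_nilpotent_radical (F : fieldType) (A : falgType F) (x : A) N :
  (forall a, x * a = a * x) -> x ^+ N = 0 -> jacobson_radical x.
Proof.
move=> xC xN L [lL nL maxL]; apply: contrapT => /negP xL.
have lK : left_ideal (L + limg (amulr x))%VS.
  apply/prodvP=> u v _ /memv_addP[l Ll [_ /memv_imgP[b _ ->] ->]].
  rewrite lfunE /= mulrDr mulrA memv_add //.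
    exact: subvP lL _ (memv_mul (memvf u) Ll).
  by apply/memv_imgP; exists (u * b); rewrite ?memvf // lfunE.
case: (maxL _ lK (addvSl _ _)) => [KL|Kf].
  case/negP: xL; rewrite -KL; apply: subvP (addvSr _ _) _ _.
  by apply/memv_imgP; exists 1; rewrite ?memvf // lfunE /= mul1r.
have /memv_addP[l Ll [_ /memv_imgP[b _ ->]]] : 1 \in (L + limg (amulr x))%VS.
  by rewrite Kf memvf.
rewrite lfunE /= => e1.
have El : l = 1 - b * x by rewrite e1 addrK.
have bxN : (b * x) ^+ N = 0.
  by rewrite exprMn_comm ?xN ?mulr0 //; rewrite /GRing.comm xC.
have : 1 \in L.
  rewrite -[1](subr0) -bxN -[X in X - _](expr1n _ N) subrXX_comm;
    last exact: commr_sym (commr1 _).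
  set s := \sum_(_ < _) _; have -> : (1 - b * x) * s = s * (1 - b * x).
    rewrite mulr_sumr mulr_suml; apply: eq_bigr => i _; rewrite expr1n mul1r.
    by rewrite mulrBl mulrBr mul1r mulr1 -exprS -exprSr.
  by rewrite -El; exact: subvP lL _ (memv_mul (memvf s) Ll).
move=> L1; case/negP: nL; rewrite eqEsubv subvf; apply/subvP => u _.
by rewrite -[u]mulr1; exact: subvP lL _ (memv_mul (memvf u) L1).
Qed.

Lemma AeA_sub (F : fieldType) (A : falgType F) (J : {vspace A}) (e : A) :
  two_sided_ideal J -> e \in J -> (AeA e <= J)%VS.
Proof.
case/andP=> lJ rJ eJ; apply: subv_trans rJ; apply: prodvSl.
by apply: subv_trans lJ; apply: prodvSr; rewrite -memvE.
Qed.

Section Levels.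

Variables (F : fieldType) (K : eqType) (I : finType).
Variables (A : falgType F) (r : I -> K) (m : I -> nat).
Variables (cf : I -> I -> nat -> A -> F) (T : I -> I -> nat -> A).
Hypothesis bA : block_algebra r m cf T.

Local Notation valid := (block_valid r m).

Definition cf_hom k l d : 'Hom(A, F^o) := linfun (HB.pack (cf k l d : A -> F^o)
  (GRing.isLinear.Build F A F^o _ (cf k l d) (cf_linear bA k l d)) : {linear A
    -> F^o}).

Lemma cf_homE k l d a : cf_hom k l d a = cf k l d a.
Proof. by rewrite lfunE. Qed.

(* The annihilator of [sum_k T k k (j (r k))]. *)
Definition level_space (j : K -> nat) : {vspace A} :=
  (\bigcap_k \bigcap_l \bigcap_(d < m l - j (r l)) lker (cf_hom k l d))%VS.

Lemma level_spaceP j a :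
  reflect (forall k l d, (d < m l - j (r l))%N -> cf k l d a = 0)
          (a \in level_space j).
Proof.
rewrite memvE; apply: (iffP subv_bigcapP) => [aj k l d lt_d|aj k _].
  have /subv_bigcapP/(_ l isT)/subv_bigcapP/(_ (Ordinal lt_d) isT) := aj k isT.
  by rewrite -memvE memv_ker cf_homE => /eqP.
apply/subv_bigcapP => l _; apply/subv_bigcapP => d _.
by rewrite -memvE memv_ker cf_homE; apply/eqP/aj.
Qed.

Lemma level_space_mull j a x : x \in level_space j -> a * x \in level_space j.
Proof.
move=> /level_spaceP xj; apply/level_spaceP => k l d lt_d.
rewrite (cf_mul bA); last by lia.
by rewrite big1 // => p _; rewrite big1 // => i _; rewrite xj ?mulr0 //; lia.
Qed.

(** A non-zero term needs [i >= m p - j (r p)], [d - i >= m l - m p] and [r p = r l]; adding these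
    gives [d >= m l - j (r l)]. *)
Lemma level_space_mulr j a x : x \in level_space j -> x * a \in level_space j.
Proof.
move=> /level_spaceP xj; apply/level_spaceP => k l d lt_d.
rewrite (cf_mul bA); last by lia.
rewrite big1 // => p _; rewrite big1 // => i _.
case: (ltnP i (m p - j (r p))) => [lt_i|le_i]; first by rewrite xj ?mul0r.
rewrite (cf_invalid bA _ (_ : ~~ valid p l (d - i)%N)) ?mulr0 //.
rewrite /block_valid; apply/negP => /andP[/eqP rpl]; rewrite rpl in le_i.
by have := ltn_ord i; lia.
Qed.

Lemma level_space_two_sided j : two_sided_ideal (level_space j).
Proof.
apply/andP; split; apply/prodvP => u v; last by move=> uj _;
  exact: level_space_mulr.
by move=> _; exact: level_space_mull.
Qed.

Lemma basis_level_space j k l d : valid k l d ->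
  (T k l d \in level_space j) = (m l - j (r l) <= d)%N.
Proof.
move=> v; apply/level_spaceP/idP => [h|le_d k' l' d' lt_d'].
  rewrite leqNgt; apply/negP => lt_d; have /eqP := h k l d lt_d.
  by rewrite (cf_basis bA) v !eqxx oner_eq0.
rewrite (cf_basis bA) v /=;
  case: (@and3P (k' == k) (l' == l) (d' == d)) => // -[/eqP _ /eqP el /eqP ed];
  subst.
by exfalso; lia.
Qed.

(** * Quotients by level ideals: shortening the blocks *)

Section Quotient.

Variables (J : proper_ideal A) (j : K -> nat).
Hypothesis JP : J = level_space j :> {vspace A}.

Let m' k := (m k - j (r k))%N.

(** Below [m' l] all elements of [J] have zero coefficients, so there the choice of representative
    is irrelevant; above, the coefficient is set to 0. *)
Definition quot_cf k l d (x : quot_alg J) : F :=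
  if (d < m' l)%N then cf k l d (quot_repr x) else 0.

Definition quot_basis k l d : quot_alg J := quot_pi J (T k l d).

(** Subtracting the same number from both sizes keeps their difference. If block [k] shrinks to size
    0, both sides are false: [m k <= j (r k)] leaves no [d] with
    [m l - m k <= d < m l - j (r l)]. *)
Lemma quot_valid k l d : block_valid r m' k l d = valid k l d && (d < m' l)%N.
Proof.
by rewrite /block_valid /m'; case: eqP => //= ->; lia.
Qed.

Lemma quot_cf_pi k l d x : (d < m' l)%N -> quot_cf k l d (quot_pi J x) = cf k l
  d x.
Proof.
move=> lt_d; rewrite /quot_cf lt_d; apply/eqP;
  rewrite eq_sym -subr_eq0 -(cfB bA).
by have := @quot_pi_decomp _ _ J x; rewrite JP => /level_spaceP->.
Qed.

Lemma quot_block_algebra : block_algebra r m' quot_cf quot_basis.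
Proof.
split.
- move=> k l d z a b; rewrite /quot_cf; case: ifP => _;
  last by rewrite mulr0 addr0.
  exact: cf_linear bA k l d z (quot_repr a) (quot_repr b).
- move=> k l d a; rewrite quot_valid /quot_cf; case: ifP => //.
  by rewrite andbT => _ /(cf_invalid bA).
- move=> k l d; case: (ltnP d (m' l)) => lt_d; last first.
    by rewrite quot_valid /quot_cf ltnNge lt_d /= andbF.
  by rewrite -quot_pi1 quot_cf_pi // (cf_one bA) quot_valid lt_d andbT.
- move=> k p d a b lt_d; rewrite -{1}[a]quot_reprK -{1}[b]quot_reprK -quot_piM.
  rewrite quot_cf_pi // (cf_mul bA); last by rewrite /m' in lt_d; lia.
  apply: eq_bigr => l _; apply: eq_bigr => i _.
  have lt_di : (d - i < m' p)%N by lia.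
  rewrite {2}/quot_cf lt_di /quot_cf; case: ltnP => // le_i.
  (* The terms with [i >= m' l], lost in the quotient, were zero already: [d < m' p] then forces
     [d - i < m p - m l]. *)
  rewrite mul0r (cf_invalid bA _ (_ : ~~ valid l p (d - i)%N)) ?mulr0 //.
  rewrite /block_valid; apply/negP => /andP[/eqP rlp].
  by move: lt_d le_i; rewrite /m' rlp; have := ltn_ord i; lia.
- move=> a a0; rewrite -[a]quot_reprK; apply/eqP; rewrite quot_pi_eq0 JP.
  apply/level_spaceP => k l d lt_d; have := a0 k l d.
  by rewrite /quot_cf lt_d.
- move=> k l d k' l' d'; case: (ltnP d' (m' l')) => lt_d.
    rewrite quot_cf_pi // (cf_basis bA) quot_valid.
    case: (@and3P (k' == k) (l' == l) (d' == d)) => [[_ /eqP el /eqP ed]|_];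
      last by rewrite !andbF.
    by rewrite -el -ed lt_d !andbT.
  rewrite /quot_cf ltnNge lt_d /= quot_valid.
  case: (@and3P (k' == k) (l' == l) (d' == d)) => [[_ /eqP el /eqP ed]|_];
    last by rewrite !andbF.
  by rewrite -el -ed ltnNge lt_d !andbF.
Qed.

End Quotient.

(** Multiplication by x on every block; for a centralizer this is the nilpotent part of the Jordan
    matrix. *)
Definition block_shift : A := \sum_k T k k 1.

Lemma cf_shift_mull k l d a : (d < m l)%N ->
  cf k l d (block_shift * a) = if d is d'.+1 then cf k l d' a else 0.
Proof.
move=> lt_d; rewrite mulr_suml (cf_sum bA) (bigD1 k) //= big1 ?addr0;
  last first.
  move=> k' nk; rewrite (cf_mul_basisl bA) // [k == _]eq_sym (negPf nk).
  by rewrite andbF.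
rewrite (cf_mul_basisl bA) // eqxx /=; case: d => [|d] in lt_d *.
  by rewrite andbF.
rewrite andbT subSS subn0; case: ifP => // nv; rewrite (cf_invalid bA) //.
by move: nv; rewrite /block_valid eqxx /=; lia.
Qed.

Lemma cf_shift_mulr k l d a : (d < m l)%N ->
  cf k l d (a * block_shift) = if d is d'.+1 then cf k l d' a else 0.
Proof.
move=> lt_d; rewrite mulr_sumr (cf_sum bA) (bigD1 l) //= big1 ?addr0;
  last first.
  move=> k' nk; rewrite (cf_mul_basisr bA) // [l == _]eq_sym (negPf nk).
  by rewrite andbF.
rewrite (cf_mul_basisr bA) // eqxx /=; case: d => [|d] in lt_d *.
  by rewrite andbF.
rewrite andbT subSS subn0; case: ifP => // nv.
by move: nv; rewrite /block_valid eqxx /=; lia.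
Qed.

Lemma block_shiftC a : block_shift * a = a * block_shift.
Proof.
apply: (cf_inj bA) => k l d /andP[_ /andP[_ lt_d]].
by rewrite cf_shift_mull // cf_shift_mulr.
Qed.

(** The element is central, and its i-th power has no coefficients in exponents below [i], so it is
    nilpotent. *)
Lemma block_shift_radical : jacobson_radical block_shift.
Proof.
apply: (@central_nilpotent_radical _ _ _ (\max_k m k));
  first exact: block_shiftC.
have shiftX i k l d : (d < m l)%N -> (d < i)%N -> cf k l d (block_shift ^+ i) =
  0.
  elim: i d => [//|i IHi] d lt_d lt_di; rewrite exprS cf_shift_mull //.
  by case: d lt_d lt_di => // d lt_d lt_di; apply: IHi; lia.
apply: (cf_inj bA) => k l d /andP[_ /andP[_ lt_d]].
rewrite (cf0 bA) shiftX //; apply: leq_trans lt_d _; exact: leq_bigmax.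
Qed.

Lemma heredity_level (H : {vspace A}) : heredity_ideal H ->
  exists2 R : {pred K}, H = level_space (fun c => R c : nat)
    & forall c, R c -> exists l, r l = c /\ m l = 1%N.
Proof.
case=> e [ee -> rad_e _].
(* With X the shift, centrality gives [X e = X e e = e X e], which is 0 because X is in the
   radical. *)
have shift_e : block_shift * e = 0.
  by have := rad_e _ block_shift_radical; rewrite -block_shiftC -mulrA ee.
have soc_e k l d : (d.+1 < m l)%N -> cf k l d e = 0.
  by move=> lt_d; have := cf_shift_mull k e lt_d; rewrite shift_e (cf0 bA).
have soc_neq0 k l d : cf k l d e != 0 -> d.+1 = m l /\ r k = r l.
  move=> cf_neq0; have : valid k l d.
    by apply: contraR cf_neq0 => nv; rewrite (cf_invalid bA).
  case/andP=> /eqP rkl /andP[_ lt_d]; split=> //; apply/eqP.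
  by rewrite eqn_leq lt_d leqNgt; apply: contra cf_neq0 => lt; rewrite soc_e.
pose R c := [exists k, exists l, (r l == c) && (cf k l (m l).-1 e != 0)].
(* Comparing coefficients in [e = e * e] yields a block [p] and an [i] with [i = m p - 1],
   [d - i = m l - 1] and [d = m l - 1]. Hence [i = 0] and [m p = 1]. *)
have factor k l d : cf k l d e != 0 ->
    exists p, [/\ m p = 1%N, r p = r l, cf k p 0 e != 0 & cf p l d e != 0].
  move=> c0; have [dl rkl] := soc_neq0 _ _ _ c0; move: c0;
    rewrite -{1}ee (cf_mul bA) -?dl //.
  move=> c0; apply: contrapT => nex; case/eqP: c0.
  apply: big1 => p _; apply: big1 => i _; apply: contrapT => /eqP.
  rewrite mulf_eq0 negb_or => /andP[c1 c2].
  have [e1 r1] := soc_neq0 _ _ _ c1; have [e2 r2] := soc_neq0 _ _ _ c2.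
  have i0 : i = 0%N :> nat by have := ltn_ord i; lia.
  case: nex; exists p; rewrite i0 ?subn0 in e1 c1 c2.
  by split.
(* Factoring twice places a non-zero coefficient of [e] between two blocks of size 1. *)
have corner c : R c -> exists q p, [/\ r q = c, m q = 1%N, r p = c, m p = 1%N &
  cf q p 0 e != 0].
  case/existsP=> k /existsP[l /andP[/eqP <- /factor[p [mp rp c1 _]]]].
  have [q [mq rq _ c2]] := factor _ _ _ c1.
  by exists q, p; rewrite rq rp.
exists R; last by move=> c /corner[q [_ [rq mq _ _ _]]]; exists q.
apply/eqP; rewrite eqEsubv; apply/andP; split.
  have eR : e \in level_space (fun c => R c : nat).
    apply/level_spaceP => k l d; case: (boolP (R (r l))) => [_|nR] lt_d.
      by apply: soc_e; lia.
    case: (ltnP d.+1 (m l)) => [/soc_e //|le_d].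
    apply: contraNeq nR => c0; apply/existsP; exists k; apply/existsP; exists l.
    by rewrite eqxx /= -(_ : d = (m l).-1) //; lia.
  exact: AeA_sub (level_space_two_sided _) eR.
have memAeA a b : a * e * b \in AeA e.
  by rewrite /AeA !memv_mul ?memvf ?memv_line.
apply/subvP => x /level_spaceP xR; rewrite [x](basis_expand bA).
apply: memv_suml => k _; apply: memv_suml => l _; apply: memv_suml => d _.
have [->|cx] := eqVneq (cf k l d x) 0; first by rewrite scale0r mem0v.
have vx : valid k l d by apply: contraR cx => nv; rewrite (cf_invalid bA).
have /andP[/eqP rkl /andP[d1 d2]] := vx.
case: (boolP (R (r l))) (xR k l d) => [Rl|nR] xR0; last first.
  by rewrite xR0 ?eqxx ?subn0 // in cx.
have dl : d.+1 = m l.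
  by apply/eqP; rewrite eqn_leq d2 leqNgt; apply: contra cx => lt;
    rewrite xR0 //; lia.
apply: memvZ; have [q [p [rq mq rp mp c0]]] := corner _ Rl.
(* Sandwiching [e] between [T q q 0] and [T p p 0] leaves only its coefficient at [(q, p, 0)]. Both
   outer factors are valid since [q] has size 1 and [d = m l - 1]. *)
have -> : T k l d = (T k q 0) * e * ((cf q p 0 e)^-1 *: T p l d).
  have eqp : T q q 0 * e * T p p 0 = cf q p 0 e *: T q p 0.
    apply: (cf_inj bA) => k' l' d' /andP[_ /andP[_ lt_d]].
    rewrite (cf_mul_basisr bA) // (cfZ bA) (cf_basis bA) /block_valid rq rp mq
      mp !eqxx /=.
    have [el|_] /= := eqVneq l' p; last by rewrite !andbF mulr0.
    rewrite el mp in lt_d; have -> : d' = 0%N by lia.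
    rewrite (cf_mul_basisl bA) ?mp // /block_valid mq !eqxx /= andbT.
    by case: eqP; rewrite ?mulr1 ?mulr0.
  rewrite -[T k q 0](basis_idr bA) -[T p l d](basis_idl bA) scalerAr.
  rewrite -[RHS]mulrA [e * _]mulrA -!scalerAr mulrA.
  rewrite -[X in X * T p l d]mulrA [T q q 0 * _]mulrA eqp -scalerAr -scalerAl.
  rewrite scalerA mulVf // scale1r !(basis_mul bA) ?rkl ?rq ?rp ?mq ?mp //;
    try lia.
exact (memAeA _ _).
Qed.

End Levels.

(** * Quasi-heredity *)

Section QuasiHereditary.

Variables (F : fieldType) (K : eqType) (I : finType).
Variables (A : falgType F) (r : I -> K) (m : I -> nat).
Variables (cf : I -> I -> nat -> A -> F) (T : I -> I -> nat -> A).
Hypothesis bA : block_algebra r m cf T.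

Local Notation valid := (block_valid r m).

Lemma level_space_quot (J : proper_ideal A) (j i : K -> nat)
    (JP : J = level_space bA j :> {vspace A}) :
  (quot_pi J @: level_space bA (fun c => j c + i c)%N)%VS =
  level_space (quot_block_algebra JP) i.
Proof.
apply/vspaceP => y; apply/idP/level_spaceP.
  case/memv_imgP=> x /level_spaceP xji -> k l d lt_d.
  by rewrite (quot_cf_pi JP) ?xji //; lia.
move=> yi; rewrite -[y]quot_reprK memv_img //; apply/level_spaceP => k l d lt_d.
by rewrite -(quot_cf_pi JP) ?quot_reprK ?yi //; lia.
Qed.

Lemma img_quot_inj (J : proper_ideal A) (U V : {vspace A}) :
  (J <= U)%VS -> (J <= V)%VS ->
  (quot_pi J @: U)%VS = (quot_pi J @: V)%VS -> U = V.
Proof.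
have sub W W' : (J <= W')%VS -> (quot_pi J @: W = quot_pi J @: W')%VS -> (W <=
  W')%VS.
  move=> JW' WW'; apply/subvP => x Wx.
  have : quot_pi J x \in (quot_pi J @: W')%VS by rewrite -WW' memv_img.
  case/memv_imgP=> y W'y /eqP; rewrite quot_pi_eq => Jxy.
  by rewrite -[x](subrK y) rpredD // (subvP JW').
by move=> JU JV UV; apply/eqP; rewrite eqEsubv; apply/andP; split; exact: sub.
Qed.

Lemma level_space0 : level_space bA (fun=> 0%N) = 0%VS.
Proof.
apply/vspaceP => x; rewrite memv0; apply/level_spaceP/eqP => [x0|-> k l d _].
  apply: (cf_inj bA) => k l d /andP[_ /andP[_ lt_d]].
  by rewrite (cf0 bA) x0 // subn0.
exact: (cf0 bA).
Qed.

Lemma level_spaceS (j j' : K -> nat) : (forall c, j c <= j' c)%N ->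
  (level_space bA j <= level_space bA j')%VS.
Proof.
move=> jj'; apply/subvP => x /level_spaceP xj; apply/level_spaceP => k l d lt_d.
by apply: xj; have := jj' (r l); lia.
Qed.

(** By induction every member of the chain is a level ideal for some [j], and each of [1, ..., j c]
    is the size of a block with eigenvalue [c]. The level at [c] rises only if the quotient has a
    block of size 1 there, which is a block of size [j c + 1] in [A]. *)
Lemma quasi_hereditary_gap_free : quasi_hereditary A ->
  forall k x, (0 < x <= m k)%N -> exists l, r l = r k /\ m l = x.
Proof.
case=> N [J [J0 JN _ Jmono Jher]].
have step i : (i <= N)%N -> exists2 j : K -> nat, J i = level_space bA j
    & forall c x, (0 < x <= j c)%N -> exists l, r l = c /\ m l = x.
  elim: i => [|i IHi] leN.
    by exists (fun=> 0%N); [rewrite J0 level_space0|move=> c x; lia].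
  have [j Jj wit] := IHi (ltnW leN).
  have [Q QJ /(heredity_level (quot_block_algebra (etrans QJ Jj)))] := Jher i
    leN.
  case=> R; rewrite -level_space_quot => eqR witR.
  have /andP[JS _] := Jmono i leN.
  exists (fun c => j c + R c)%N.
    apply: img_quot_inj eqR; rewrite QJ // Jj; apply: level_spaceS => c.
    exact: leq_addr.
  move=> c x; case: (leqP x (j c)) => [le_x x0|lt_x le_x].
    by apply: wit; lia.
  case: (boolP (R c)) le_x => [/witR[l [rl ml]]|_] le_x; last by lia.
  by exists l; split=> //; rewrite rl in ml; lia.
have [j JNj wit] := step N (leqnn N).
move=> k x /andP[x0 le_x]; apply: wit; rewrite x0 /=; apply: leq_trans le_x _.
rewrite leqNgt; apply/negP => lt_j.
(* The last ideal contains [T k k 0], which forces [m k <= j (r k)]. *)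
have v : valid k k 0 by rewrite /block_valid eqxx subnn /=; lia.
have := basis_level_space bA j v; rewrite -JNj JN memvf; lia.
Qed.

(** * The annihilator of the shift as a heredity ideal *)

Section Sufficiency.

(** The coefficient is read off from a maximal left ideal [L]: the annihilator of the coordinate
    vector [l] in the simple module of the class of [l]. *)
Lemma radical_cf0 x k l : jacobson_radical x -> r k = r l -> m k = m l ->
  (0 < m l)%N -> cf k l 0 x = 0.
Proof.
move=> rad_x rkl mkl ml.
pose cls k' := (r k' == r l) && (m k' == m l).
pose L := (\bigcap_(k' | cls k') lker (cf_hom bA k' l 0))%VS.
have LP a : reflect (forall k', cls k' -> cf k' l 0 a = 0) (a \in L).
  rewrite memvE; apply: (iffP subv_bigcapP) => La k' /La.
    by rewrite -memvE memv_ker cf_homE => /eqP.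
  by rewrite -memvE memv_ker cf_homE => /eqP.
have ckl : cls k by rewrite /cls rkl mkl !eqxx.
have cll : cls l by rewrite /cls !eqxx.
have vcls k' k'' : cls k' -> cls k'' -> valid k' k'' 0.
  case/andP=> /eqP r1 /eqP m1 /andP[/eqP r2 /eqP m2].
  by rewrite /block_valid r1 r2 m1 m2 eqxx subnn.
have lL : left_ideal L.
  apply/prodvP => a b _ /LP Lb; apply/LP => k' ck'; rewrite (cf_mul bA) //.
  rewrite big1 // => p _; rewrite big_ord1 /=.
  have [cp|ncp] := boolP (cls p); first by rewrite Lb ?mulr0.
  have [vk'p|nv] := boolP (valid k' p 0);
    last by rewrite (cf_invalid bA) ?mul0r.
  rewrite [X in _ * X](cf_invalid bA) ?mulr0 //; apply: contra ncp.
  case/andP: ck' => /eqP rk' /eqP mk'; move: vk'p;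
    rewrite /block_valid /cls rk' mk'.
  by case/and3P=> /eqP <- ? ? /and3P[_ ? ?]; rewrite eqxx /=; lia.
suff maxL : maximal_left_ideal L by have /LP/(_ k ckl) := rad_x L maxL.
split=> // [|S lS LS].
  apply/eqP => Lf; have : T l l 0 \in L by rewrite Lf memvf.
  by move/LP/(_ l cll)/eqP; rewrite (cf_basis bA) vcls // !eqxx oner_eq0.
have [eqSL|nSL] := eqVneq S L; [by left | right].
have [a Sa [k' ck' ca]] : exists2 a, a \in S & exists2 k', cls k' & cf k' l 0 a
  != 0.
  apply: contrapT => nex; case/eqP: nSL; apply/eqP; rewrite eqEsubv LS andbT.
  apply/subvP => a Sa; apply/LP => k' ck'; apply: contrapT => /eqP ca.
  by case: nex; exists a => //; exists k'.
apply/eqP; rewrite eqEsubv subvf; apply/subvP => z _.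
(* [w] is a multiple of [a] with the same degree-0 coefficients as [z] in column [l], so [z - w]
   lies in [L]. *)
pose w := \sum_(p | cls p) (cf p l 0 z / cf k' l 0 a) *: (T p k' 0 * a).
have Sw : w \in S.
  apply: memv_suml => p _; apply: memvZ.
  by apply: subvP lS _ (memv_mul (memvf _) Sa).
rewrite -[z](subrK w) rpredD // (subvP LS) //; apply/LP => p cp.
rewrite (cfB bA) (cf_sum bA) (bigD1 p) //= big1 ?addr0.
  by rewrite (cfZ bA) (cf_mul_basisl bA) // vcls // eqxx /= divfK // subrr.
move=> p' /andP[_ np]; rewrite (cfZ bA) (cf_mul_basisl bA) //.
by rewrite [p == _]eq_sym (negPf np) andbF mulr0.
Qed.

Hypothesis has1 : forall l, (0 < m l)%N -> exists p, r p = r l /\ m p = 1%N.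

Local Notation soc := (level_space bA (fun=> 1%N)).

Definition socle_idem : A := \sum_(k | m k == 1%N) T k k 0.

(** Under [has1] the default [l] can occur only when [m l = 0]. *)
Definition socle_proj l : I := odflt l [pick p | (r p == r l) && (m p == 1%N)].

Lemma socle_projP l : (0 < m l)%N ->
  r (socle_proj l) = r l /\ m (socle_proj l) = 1%N.
Proof.
rewrite /socle_proj => /has1[p [rp mp]];
  case: pickP => [q /andP[/eqP-> /eqP->] //|].
by move/(_ p); rewrite rp mp !eqxx.
Qed.

Lemma cf_soc k l d x : x \in soc -> (d.+1 < m l)%N -> cf k l d x = 0.
Proof. by move=> /level_spaceP xs lt_d; apply: xs; lia. Qed.

Definition socle_coord l (x : A) : A :=
  \sum_k cf k l (m l).-1 x *: T k (socle_proj l) 0.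

Lemma cf_socle_coord l x k q d : (d < m q)%N ->
  cf k q d (socle_coord l x) =
  if (q == socle_proj l) && (d == 0%N) then cf k l (m l).-1 x else 0.
Proof.
move=> lt_d; rewrite (cf_sum bA) (bigD1 k) //= big1 ?addr0; last first.
  move=> k' nk; rewrite (cfZ bA) (cf_basis bA).
  by rewrite [k == _]eq_sym (negPf nk) andbF mulr0.
rewrite (cfZ bA) (cf_basis bA) eqxx /=; case: ifP => [_|];
  last by rewrite andbF mulr0.
have [v|nv] := boolP (valid k l (m l).-1);
  last by rewrite (cf_invalid bA) // mul0r.
have /andP[/eqP rkl lt_m] := v; have [rp mp] := @socle_projP l ltac:(lia).
rewrite /block_valid rp mp rkl eqxx andbT [(_ && _)%N](_ : _ = true) ?mulr1 //.
by lia.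
Qed.

(** In column [l], an element of [soc] has coefficients only at the top exponent [m l - 1]. So only
    degree-0 coefficients of [a] enter the top coefficient of [a * x], exactly as in a product
    ending in a block of size 1. *)
Lemma socle_coordM l a x : x \in soc ->
  socle_coord l (a * x) = a * socle_coord l x.
Proof.
move=> xs; apply: (cf_inj bA) => k q d /andP[_ /andP[_ lt_d]].
case: (posnP (m l)) => [ml0|ml_gt0].
  have sc0 b : socle_coord l b = 0.
    rewrite /socle_coord big1 // => k' _; rewrite (cf_invalid bA) ?scale0r //.
    by rewrite /block_valid ml0 ltn0 !andbF.
  by rewrite !sc0 mulr0.
have [_ mp] := socle_projP ml_gt0.
rewrite cf_socle_coord // [RHS](cf_mul bA) //.
have [eq_q|nq] /= := eqVneq q (socle_proj l); last first.
  rewrite big1 // => p _; rewrite big1 // => i _.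
  by rewrite cf_socle_coord ?(negPf nq) ?mulr0 //; lia.
have -> : d = 0%N by move: lt_d; rewrite eq_q mp; lia.
rewrite eqxx (cf_mul bA); last by lia.
apply: eq_bigr => p _; rewrite big_ord_recl big_ord1 /= big1 ?addr0.
  by rewrite !subn0 cf_socle_coord ?eq_q ?mp // !eqxx.
by move=> i _; rewrite [X in _ * X]cf_soc ?mulr0 // /bump leq0n add1n;
  have := ltn_ord i; lia.
Qed.

Lemma socle_expand x : x \in soc ->
  x = \sum_l socle_coord l x * T (socle_proj l) l (m l).-1.
Proof.
move=> xs; apply: (cf_inj bA) => k q d /andP[_ /andP[_ lt_d]].
have [rp mp] := @socle_projP q ltac:(lia).
rewrite (cf_sum bA) (bigD1 q) //= [X in _ + X]big1 ?addr0; last first.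
  by move=> l nl; rewrite (cf_mul_basisr bA) // eq_sym (negPf nl) andbF.
rewrite (cf_mul_basisr bA) // eqxx /block_valid rp mp eqxx /=.
case: (ltnP d.+1 (m q)) => [lt|le].
  by rewrite cf_soc //; case: ifP => //; lia.
rewrite cf_socle_coord ?mp; last by lia.
have -> : d = (m q).-1 by lia.
rewrite subnn !eqxx /= leqnn andbT; case: ifP => //; lia.
Qed.

Lemma socle_idem_sqr : socle_idem * socle_idem = socle_idem.
Proof.
rewrite {1}/socle_idem mulr_suml; apply: eq_bigr => k mk.
rewrite /socle_idem mulr_sumr (bigD1 k) //= big1 ?addr0 ?(basis_idl bA) //.
by move=> l /andP[_ nl]; rewrite (basis_mul0 bA) // eq_sym.
Qed.

Lemma basis_socle_idem k l d : m l = 1%N -> T k l d * socle_idem = T k l d.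
Proof.
move=> ml; rewrite mulr_sumr (bigD1 l) ?ml //= big1 ?addr0 ?(basis_idr bA) //.
by move=> l' /andP[_ nl]; rewrite (basis_mul0 bA) // eq_sym.
Qed.

(** In [socle_expand], each coordinate ends in a block of size 1, where right multiplication by the
    idempotent is the identity; so the idempotent can be inserted in the middle of every summand. *)
Lemma socle_AeA : soc = AeA socle_idem.
Proof.
apply/eqP; rewrite eqEsubv; apply/andP; split; last first.
  apply: AeA_sub; first exact: level_space_two_sided.
  apply: memv_suml => k /eqP mk; rewrite (basis_level_space bA) ?mk //.
  by rewrite /block_valid mk eqxx.
apply/subvP => x xs; rewrite (socle_expand xs); apply: memv_suml => l _.
case: (posnP (m l)) => [ml0|ml_gt0].
  by rewrite (basis_big bA) ?ml0 ?mulr0 ?mem0v.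
have [_ mp] := socle_projP ml_gt0; rewrite mulr_suml; apply: memv_suml => k _.
rewrite -(basis_socle_idem _ _ mp) -scalerAl; apply: memvZ.
by rewrite /AeA !memv_mul ?memvf ?memv_line.
Qed.

(** Between blocks of size 1 only exponent 0 occurs, and radical elements have no such coefficients
    by [radical_cf0]. *)
Lemma socle_idem_radical x : jacobson_radical x -> socle_idem * x * socle_idem
  = 0.
Proof.
move=> rad_x; rewrite !mulr_suml big1 // => k /eqP mk.
rewrite mulr_sumr big1 // => l /eqP ml.
apply: (cf_inj bA) => k' l' d /andP[_ /andP[_ lt_d]]; rewrite (cf0 bA).
rewrite (cf_mul_basisr bA) //; case: ifP => // /and3P[_ /eqP el _].
have -> : d = 0%N by rewrite el ml in lt_d; lia.
rewrite (cf_mul_basisl bA) ?ml //; case: ifP => // _; rewrite subnn.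
have [/andP[/eqP rkl _]|nv] := boolP (valid k l 0); last exact: (cf_invalid bA).
by apply: radical_cf0; rewrite ?mk ?ml.
Qed.

(* [AeA] is the direct sum over the blocks l of modules isomorphic to
   [A T p p 0], p a block of size 1 with the eigenvalue of l: right
   multiplication by [T p l (m l).-1] maps [A T p p 0] onto the component, with inverse
   [socle_coord l]. *)
Lemma socle_projective :
  projective_module (lideal_module (AeA_left_ideal socle_idem) : lmodType A).
Proof.
set P := lideal_module _.
move=> M N g f g_surj.
have valP (u : P) : vsval u \in soc by rewrite socle_AeA; exact: subvsP.
have memT l : (0 < m l)%N -> T (socle_proj l) l (m l).-1 \in AeA socle_idem.
  move=> ml; have [rp mp] := socle_projP ml.
  rewrite -socle_AeA (basis_level_space bA); first by lia.
  by rewrite /block_valid rp mp eqxx; lia.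
(* The projection makes [t l] an element of [P] for every [l]; when [m l = 0] it is zero. *)
pose t l : P := vsproj (AeA socle_idem) (T (socle_proj l) l (m l).-1).
have tE l : vsval (t l) = T (socle_proj l) l (m l).-1.
  case: (posnP (m l)) => [ml0|/memT ml]; last exact: vsprojK.
  by rewrite /t (basis_big bA) ?ml0 // linear0.
have exy l : exists y, g y == f (t l) by have [y <-] := g_surj (f (t l));
  exists y.
pose y l := xchoose (exy l).
have gy l : g (y l) = f (t l) by exact/eqP/(xchooseP (exy l)).
(* The lift sends [t l] to a chosen preimage [y l] of [f (t l)]; it is [A]-linear by
   [socle_coordM]. *)
pose h (u : P) : M := \sum_l socle_coord l (vsval u) *: y l.
have coordD l x x' : socle_coord l (x + x') = socle_coord l x + socle_coord l
  x'.
  by rewrite -big_split; apply: eq_bigr => k _; rewrite (cfD bA) scalerDl.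
have hlin : linear h.
  move=> a u v; rewrite /h scaler_sumr -big_split; apply: eq_bigr => l _ /=.
  rewrite scalerA -scalerDl -socle_coordM //.
  by rewrite -coordD.
exists (HB.pack h (GRing.isLinear.Build A P M _ h hlin) : {linear P -> M}) => u
  /=.
rewrite /h linear_sum /=;
  transitivity (f (\sum_l socle_coord l (vsval u) *: t l)).
  by rewrite linear_sum; apply: eq_bigr => l _; rewrite !linearZ /= gy.
congr (f _); apply: val_inj.
rewrite [RHS](socle_expand (valP u)) /=.
rewrite (big_morph (fun w : P => vsval w) (id1 := 0) (op1 := +%R)) //=.
by apply: eq_bigr => l _; rewrite /= tE.
Qed.

Lemma socle_heredity : heredity_ideal soc.
Proof.
exists socle_idem; split.
- exact: socle_idem_sqr.
- exact: socle_AeA.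
- exact: socle_idem_radical.
- exact: socle_projective.
Qed.

End Sufficiency.

End QuasiHereditary.

Theorem gap_free_quasi_hereditary (F : fieldType) (K : eqType) (I : finType)
    (A : falgType F) (r : I -> K) (m : I -> nat)
    (cf : I -> I -> nat -> A -> F) (T : I -> I -> nat -> A)
    (bA : block_algebra r m cf T) :
  (forall k x, (0 < x <= m k)%N -> exists l, r l = r k /\ m l = x) ->
  quasi_hereditary A.
Proof.
move=> gap_free; pose N := \max_k m k.
pose S i := level_space bA (fun=> i).
have not_mem i : (i < N)%N -> exists2 x, x \in S i.+1 & x \notin S i.
  move=> ltN; have [k mk] : exists k, m k = N.
    have [|k Ek] := @eq_bigmax I m; last by exists k; rewrite -Ek.
    rewrite lt0n; apply: contraTneq ltN => /card0_eq I0.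
    by rewrite /N big_pred0.
  (* On a block of maximal size [N], the exponent [N - (i + 1)] is the least one allowed in level
     [i + 1], so it separates the two levels. *)
  have v : block_valid r m k k (N - i.+1)%N by rewrite /block_valid eqxx mk;
    lia.
  exists (T k k (N - i.+1)%N); first by rewrite (basis_level_space bA) ?mk.
  by rewrite (basis_level_space bA) ?mk //; lia.
exists N, S; split.
- exact: level_space0.
- apply/eqP; rewrite eqEsubv subvf; apply/subvP => x _;
  apply/level_spaceP => k l d.
  by have : (m l <= N)%N by [exact: leq_bigmax]; lia.
- by move=> i _; exact: level_space_two_sided.
- move=> i ltN; rewrite level_spaceS //=; have [x xS nxS] := not_mem i ltN.
  by apply: contraNneq nxS => ->.
move=> i ltN; have [x _ nxS] := not_mem i ltN.
have Sproper : two_sided_ideal (S i) && (S i != fullv).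
  rewrite level_space_two_sided /=; apply: contraNneq nxS => ->; exact: memvf.
pose J := ProperIdeal Sproper; have JP : J = S i :> {vspace A} by [].
exists J => //; have -> : S i.+1 = level_space bA (fun=> i + 1)%N by rewrite
  addn1.
(* All sizes drop by [i] in the quotient, so the required block of size 1 comes from a block of size
   [i + 1], present because there are no gaps. *)
rewrite (level_space_quot (fun=> 1%N) JP); apply: socle_heredity => l ml.
have [|p [rp mp]] := gap_free l i.+1; first by lia.
by exists p; rewrite mp; split=> //; lia.
Qed.

(** * Centralizers of Jordan matrices *)

Section Entries.

Variable R : fieldType.

(** Extension by zero to all pairs of naturals, so that shifted indices need no bound proofs and
    boundary rows obey the same relation. *)
Definition mx_entry p q (M : 'M[R]_(p, q)) (x y : nat) : R :=
  if insub x is Some i then if insub y is Some j then M i j else 0 else 0.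

Variables p q : nat.
Implicit Types M : 'M[R]_(p, q).

Lemma mx_entryE M (i : 'I_p) (j : 'I_q) : mx_entry M i j = M i j.
Proof. by rewrite /mx_entry !valK. Qed.

Lemma mx_entry_lt M x y (lt_x : (x < p)%N) (lt_y : (y < q)%N) :
  mx_entry M x y = M (Ordinal lt_x) (Ordinal lt_y).
Proof. exact: (mx_entryE M (Ordinal lt_x) (Ordinal lt_y)). Qed.

Lemma mx_entry_out M x y : (p <= x)%N || (q <= y)%N -> mx_entry M x y = 0.
Proof.
rewrite /mx_entry; case: insubP => [i _ <-|] //; case: insubP => [j _ <-|] //.
by move=> /= h; exfalso; have := ltn_ord i; have := ltn_ord j; lia.
Qed.

Lemma mx_entryP M : (forall x y, (x < p)%N -> (y < q)%N -> mx_entry M x y = 0)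
  -> M = 0.
Proof. by move=> M0; apply/matrixP => i j; rewrite mxE -mx_entryE M0. Qed.

Lemma mx_entry_linear x y z M N :
  mx_entry (z *: M + N) x y = z * mx_entry M x y + mx_entry N x y.
Proof.
rewrite /mx_entry; case: insub => [i|]; last by rewrite mulr0 addr0.
by case: insub => [j|]; rewrite ?mxE // mulr0 addr0.
Qed.

Lemma mx_entry_jordanl r M x y : (x < p)%N ->
  mx_entry (jordan_block p r *m M) x y = r * mx_entry M x y + mx_entry M x.+1 y.
Proof.
move=> lt_x; case: (ltnP y q) => [lt_y|le_y]; last first.
  by rewrite !mx_entry_out ?mulr0 ?addr0 // le_y orbT.
rewrite !(mx_entry_lt _ lt_x lt_y) mxE (bigD1 (Ordinal lt_x)) //= mxE eqxx.
congr (_ + _); case: (ltnP x.+1 p) => [lt_Sx|le_p].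
  rewrite (mx_entry_lt _ lt_Sx lt_y) (bigD1 (Ordinal lt_Sx)) /=; last first.
    by rewrite -val_eqE /=; lia.
  rewrite mxE -val_eqE /= eqxx; case: eqP => [?|_]; first by exfalso; lia.
  rewrite mul1r big1 ?addr0 // => k /andP[];
    rewrite -!val_eqE /= mxE -!val_eqE /=.
  by rewrite [x == k]eq_sym => /negPf-> /negPf->; rewrite mul0r.
rewrite mx_entry_out ?le_p // big1 // => k;
  rewrite mxE -!val_eqE /= eq_sym => /negPf->.
by case: eqP => [e|_]; rewrite ?mul0r //; have := ltn_ord k; lia.
Qed.

Lemma mx_entry_jordanr r M x y : (y < q)%N ->
  mx_entry (M *m jordan_block q r) x y =
  r * mx_entry M x y + (if y is y'.+1 then mx_entry M x y' else 0).
Proof.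
move=> lt_y; case: (ltnP x p) => [lt_x|le_x]; last first.
  rewrite !mx_entry_out ?le_x // mulr0 add0r.
  by case: y lt_y => // y lt_y; rewrite mx_entry_out ?le_x.
rewrite !(mx_entry_lt _ lt_x lt_y) mxE (bigD1 (Ordinal lt_y)) //= mxE eqxx.
rewrite mulrC; congr (_ + _); case: y lt_y => [|y] lt_y.
  by rewrite big1 // => k; rewrite mxE -!val_eqE /= => /negPf->; rewrite mulr0.
have lt_y' := ltnW lt_y; rewrite (mx_entry_lt _ lt_x lt_y').
rewrite (bigD1 (Ordinal lt_y')) /=; last by rewrite -val_eqE /=; lia.
rewrite mxE -val_eqE /= eqxx; case: eqP => [?|_]; first by exfalso; lia.
rewrite mulr1 big1 ?addr0 // => k /andP[];
  rewrite -!val_eqE /= mxE -!val_eqE /=.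
by rewrite eqSS [y == k]eq_sym => /negPf-> /negPf->; rewrite mulr0.
Qed.

Lemma mx_entry0 x y : mx_entry (0 : 'M[R]_(p, q)) x y = 0.
Proof. by rewrite /mx_entry; case: insub => // i; case: insub => // j;
  rewrite mxE. Qed.

Section Commuting.

Variables (r r' : R) (M : 'M[R]_(p, q)).
Hypothesis comM : jordan_block p r *m M = M *m jordan_block q r'.

Local Notation f := (mx_entry M).

Lemma commuting_entry x y : (x < p)%N -> (y < q)%N ->
  r * f x y + f x.+1 y = r' * f x y + (if y is y'.+1 then f x y' else 0).
Proof. by move=> lt_x lt_y;
  rewrite -mx_entry_jordanl // comM mx_entry_jordanr. Qed.

(** The relation expresses [(r - r') f x y] through the entries to the left and below; induction
    runs on the column and, inside it, upwards from the last row. *)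
Lemma commuting_neq x y : r != r' -> f x y = 0.
Proof.
move=> nr; elim: y x => [|y IHy] x.
  have [n le_n] := ubnP (p - x); elim: n x le_n => // n IHn x le_n.
  case: (leqP p x) => [le|lt_x]; first by rewrite mx_entry_out ?le.
  case: (leqP q 0) => [le|lt_y]; first by rewrite mx_entry_out ?le ?orbT.
  have /eqP := commuting_entry lt_x lt_y; rewrite (IHn x.+1); last by lia.
  by rewrite !addr0 -subr_eq0 -mulrBl mulf_eq0 subr_eq0 (negPf nr) => /eqP.
have [n le_n] := ubnP (p - x); elim: n x le_n => // n IHn x le_n.
case: (leqP p x) => [le|lt_x]; first by rewrite mx_entry_out ?le.
case: (leqP q y.+1) => [le|lt_y]; first by rewrite mx_entry_out ?le ?orbT.
have /eqP := commuting_entry lt_x lt_y; rewrite (IHn x.+1); last by lia.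
by rewrite IHy !addr0 -subr_eq0 -mulrBl mulf_eq0 subr_eq0 (negPf nr) => /eqP.
Qed.

(** For equal eigenvalues, [f x.+1 y] is the entry diagonally above it, or 0 in the first column. *)
Lemma commuting_toeplitz x y : r = r' -> (x < p)%N -> (y < q)%N ->
  f x y = if (x <= y)%N then f 0%N (y - x)%N else 0.
Proof.
move=> er; elim: x y => [|x IHx] y lt_x lt_y; first by rewrite subn0.
have := commuting_entry (ltnW lt_x) lt_y; rewrite er => /addrI ->.
by case: y lt_y => // y lt_y; rewrite IHx ?subSS //; lia.
Qed.

(** In the last row, at column [d + p < q], the relation says that [f p.-1 (d + p.-1)] is 0, and
    this entry lies on the diagonal of [f 0 d]. *)
Lemma commuting_first_row d : r = r' -> (d < q - p)%N -> f 0%N d = 0.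
Proof.
move=> er lt_d; case: (posnP p) => [p0|p_gt0].
  by rewrite mx_entry_out ?p0.
have := @commuting_entry p.-1 (d + p.-1).+1.
rewrite prednK // (@mx_entry_out M p) ?leqnn // er.
move=> /(_ ltac:(lia) ltac:(lia))/addrI.
by rewrite (@commuting_toeplitz p.-1) ?leq_addl ?addnK //; lia.
Qed.

End Commuting.

Lemma toeplitz_commutes r d : (q - p <= d)%N ->
  let M : 'M[R]_(p, q) := \matrix_(i, j) (val j == (i + d)%N)%:R in
  jordan_block p r *m M = M *m jordan_block q r.
Proof.
move=> le_d M; apply/matrixP => i j; rewrite -!mx_entryE.
rewrite mx_entry_jordanl // mx_entry_jordanr //; congr (_ + _).
have ME x y : (x < p)%N -> (y < q)%N -> mx_entry M x y = (y == (x + d)%N)%:R.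
  by move=> lt_x lt_y; rewrite (mx_entry_lt _ lt_x lt_y) mxE.
have lt_i := ltn_ord i; have lt_j := ltn_ord j.
case: (ltnP i.+1 p) => [lt_Si|le_Si].
  rewrite ME //; case: (val j) lt_j => [|y] lt_j /=; first by [].
  by rewrite ME ?addSn ?eqSS //; lia.
(* In the last row a 1 would need column [p - 1 + d >= q - 1], but the column here is less than
   [q - 1]. *)
rewrite mx_entry_out ?le_Si //; case: (val j) lt_j => [|y] lt_j //=.
rewrite ME; [|lia|lia]; case: eqP => // e; exfalso; lia.
Qed.

End Entries.

Section Centralizer.

Variables (R : fieldType) (n : nat) (c : 'M[R]_n.+1).
Variables (N : nat) (r : 'I_N -> R) (m : 'I_N -> nat).
Variables (U : 'M[R]_(\sum_i m i, n.+1)) (V : 'M[R]_(n.+1, \sum_i m i)).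
Hypothesis UV : U *m V = 1%:M.
Hypothesis VU : V *m U = 1%:M.
Hypothesis UcV : U *m c *m V = \mxdiag_i jordan_block (m i) (r i).

Local Notation A := (centralizer_alg c).
Local Notation valid := (block_valid r m).

Definition centralizer_block (a : A) k l : 'M[R]_(m k, m l) :=
  submxblock (U *m vsval a *m V) k l.

(* Matrices act on row vectors, so that the first basis vector of a block
   generates it and the first row of a component determines the component. *)
Definition centralizer_cf k l d (a : A) : R :=
  mx_entry (centralizer_block a k l) 0 d.

(** The test for validity makes invalid basis elements zero and keeps the matrix inside the
    centralizer. *)
Definition toeplitz_mx k l d : 'M[R]_n.+1 :=
  V *m (\mxblock_(i, j) (if [&& valid k l d, i == k & j == l]
    then \matrix_(x, y) (val y == (x + d)%N)%:R else 0)) *m U.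

Definition centralizer_basis k l d : A := vsproj 'C[c]%VS (toeplitz_mx k l d).

Lemma centralizer_block_comm a k l :
  jordan_block (m k) (r k) *m centralizer_block a k l =
  centralizer_block a k l *m jordan_block (m l) (r l).
Proof.
have /cent1vP ac : vsval a \in 'C[c]%VS by exact: subvsP.
set G := U *m vsval a *m V.
have : (\mxdiag_i jordan_block (m i) (r i)) *m G = G *m \mxdiag_i jordan_block
  (m i) (r i).
  rewrite -UcV /G !mulmxA -[_ *m V *m U]mulmxA VU mulmx1 -[U *m c *m _]mulmxA.
  rewrite -[U *m vsval a *m V *m U]mulmxA VU mulmx1 -[U *m vsval a *m c]mulmxA.
  by have -> : c *m vsval a = vsval a *m c by [].
rewrite -{1 2}[G]submxblockK mul_mxdiag_mxblock mul_mxblock_mxdiag =>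
  /eq_mxblockP.
exact.
Qed.

Lemma centralizer_block1 k l x y : (x < m k)%N -> (y < m l)%N ->
  mx_entry (centralizer_block 1 k l) x y = ((l == k) && (y == x))%:R.
Proof.
move=> lt_x lt_y; rewrite (mx_entry_lt _ lt_x lt_y).
have a1 : vsval (1 : A) = 1%:M by apply/eqP; rewrite algid_eq1 cent1v1.
rewrite /centralizer_block a1 mulmx1 UV !mxE -val_eqE /= tagnat.eq_Rank /=.
by rewrite eq_sym [y == x]eq_sym.
Qed.

Lemma centralizer_blockM a b k p :
  centralizer_block (a * b) k p =
  \sum_l centralizer_block a k l *m centralizer_block b l p.
Proof.
rewrite /centralizer_block.
have -> : U *m vsval (a * b) *m V = (U *m vsval a *m V) *m (U *m vsval b *m V).
  by rewrite !mulmxA -[_ *m V *m U]mulmxA VU mulmx1 -[U *m vsval a *m vsval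
    b]mulmxA.
set G := U *m vsval a *m V; set H := U *m vsval b *m V.
by rewrite -{1}[G]submxblockK -{1}[H]submxblockK mul_mxblock mxblockK.
Qed.

Lemma toeplitz_mx_cent k l d : toeplitz_mx k l d \in 'C[c]%VS.
Proof.
pose D := \mxdiag_i jordan_block (m i) (r i).
have cE : c = V *m D *m U.
  by rewrite /D -UcV !mulmxA VU mul1mx -mulmxA VU mulmx1.
apply/cent1vP; rewrite cE /toeplitz_mx -[RHS]/(_ *m _) -[LHS]/(_ *m _).
set B := \mxblock_(i, j) _.
have BD : B *m D = D *m B.
  rewrite mul_mxblock_mxdiag mul_mxdiag_mxblock; apply: eq_mxblock => i j.
  case: and3P => [[/andP[/eqP er /andP[le_d _]] /eqP-> /eqP->]|_].
    by rewrite -er (toeplitz_commutes _ le_d).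
  by rewrite mul0mx mulmx0.
rewrite !mulmxA -[_ *m U *m V]mulmxA UV mulmx1 -[_ *m U *m V]mulmxA UV mulmx1.
by rewrite -[V *m B *m D]mulmxA BD !mulmxA.
Qed.

Lemma centralizer_block_algebra :
  block_algebra (A := A) r m centralizer_cf centralizer_basis.
Proof.
have cf_out k l d a : ~~ valid k l d -> centralizer_cf k l d a = 0.
  rewrite /block_valid negb_and => /orP[nr|nd].
    exact: commuting_neq (centralizer_block_comm a k l) _ _ nr.
  have [er|nr] := eqVneq (r k) (r l); last first.
    exact: commuting_neq (centralizer_block_comm a k l) _ _ nr.
  case: (ltnP d (m l - m k)) => [lt|le].
    exact (commuting_first_row (centralizer_block_comm a k l) er lt).
  by rewrite /centralizer_cf mx_entry_out //; lia.
have shift k l x y a : (x < m k)%N -> (y < m l)%N -> 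
    mx_entry (centralizer_block a k l) x y =
    if (x <= y)%N then centralizer_cf k l (y - x) a else 0.
  move=> lt_x lt_y; have [er|nr] := eqVneq (r k) (r l).
    exact (commuting_toeplitz (centralizer_block_comm a k l) er lt_x lt_y).
  rewrite cf_out; last by rewrite /block_valid (negPf nr).
  by rewrite (commuting_neq (centralizer_block_comm a k l)) // if_same.
split=> //.
- move=> k l d z a b; rewrite -mx_entry_linear; congr mx_entry.
  rewrite /centralizer_block;
    have -> : vsval (z *: a + b) = z *: vsval a + vsval b by [].
  rewrite mulmxDr -scalemxAr mulmxDl -scalemxAl.
  by apply/matrixP => i j; rewrite !mxE.
- move=> k l d; have [v|nv] := boolP (valid k l d); last exact: cf_out.
  by rewrite /centralizer_cf centralizer_block1 //; move: v;
    rewrite /block_valid; lia.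
- move=> k p d a b lt_d; rewrite /centralizer_cf centralizer_blockM.
  case: (posnP (m k)) => [mk0|mk_gt0].
    rewrite mx_entry_out ?mk0 // big1 // => l _; rewrite big1 // => i _.
    by rewrite [X in X * _]mx_entry_out ?mk0 ?mul0r.
  rewrite (mx_entry_lt _ mk_gt0 lt_d) summxE; apply: eq_bigr => l _.
  rewrite mxE.
  transitivity (\sum_(y < m l) if (y <= d)%N
    then centralizer_cf k l y a * centralizer_cf l p (d - y) b else 0).
    apply: eq_bigr => y _; rewrite -!mx_entryE /= (shift l p y d b) //.
    by case: ifP; rewrite ?mulr0.
  (* The sums over [y < m l] and [y <= d] are compared on a common range; [f y] vanishes for
     [y >= m l]. *)
  pose f y := centralizer_cf k l y a * centralizer_cf l p (d - y) b.
  rewrite (big_ord_widen (m l + d.+1) (fun y => if (y <= d)%N then f y else 0))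
    ?leq_addr //.
  rewrite [RHS](big_ord_widen (m l + d.+1) f) ?leq_addl //.
  rewrite [LHS]big_mkcond [RHS]big_mkcond /=; apply: eq_bigr => y _.
  rewrite ltnS; case: (ltnP y (m l)) => // le_y;
    rewrite /f [X in X * _]cf_out ?mul0r ?if_same //.
  by rewrite /block_valid; lia.
- move=> a a0; have G0 : U *m vsval a *m V = 0.
    rewrite -[LHS]submxblockK -[RHS]submxblockK; apply: eq_mxblock => k l.
    rewrite submxblock0; apply: mx_entryP => x y lt_x lt_y.
    by rewrite [LHS](shift k l x y a lt_x lt_y) a0 if_same.
  apply: val_inj => /=; transitivity (V *m (U *m vsval a *m V) *m U).
    by rewrite !mulmxA VU mul1mx -mulmxA VU mulmx1.
  by rewrite G0 mulmx0 mul0mx.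
move=> k l d k' l' d';
  rewrite /centralizer_cf /centralizer_block vsprojK ?toeplitz_mx_cent //.
rewrite /toeplitz_mx !mulmxA UV mul1mx -mulmxA UV mulmx1 mxblockK.
have [v|nv] /= := boolP (valid k l d); last by rewrite mx_entry0.
have [ek|_] /= := eqVneq k' k; last by rewrite mx_entry0.
have [el|_] /= := eqVneq l' l; last by rewrite mx_entry0.
have /and3P[_ d1 d2] := v; subst k' l'; case: (ltnP d' (m l)) => [lt|le].
  have mk : (0 < m k)%N by lia.
  by rewrite (mx_entry_lt _ mk lt) mxE /= add0n.
by rewrite mx_entry_out ?le ?orbT //; case: eqP => // e; exfalso; lia.
Qed.

End Centralizer.

(** * Block types *)

Lemma conj_castmx (R : fieldType) n n' (e : n' = n) (u c v : 'M[R]_n) :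
  castmx (esym e, erefl n) u *m c *m castmx (erefl n, esym e) v =
  castmx (esym e, esym e) (u *m c *m v).
Proof. by case: _ / e u c v. Qed.

Lemma castmx1 (R : fieldType) n n' (e : n = n') :
  castmx (e, e) (1%:M : 'M[R]_n) = 1%:M.
Proof. by case: _ / e. Qed.

Lemma castmx_mulVK (R : fieldType) n n' (e : n' = n) (u v : 'M[R]_n) :
  castmx (erefl n, esym e) v *m castmx (esym e, erefl n) u = v *m u.
Proof. by case: _ / e u v. Qed.

(** * Decreasing lists of sizes without gap *)

Section GapFreeLists.

Definition gap_free_seq (l : seq nat) :=
  forall x y, y \in l -> (0 < x <= y)%N -> x \in l.

Variable l : seq nat.
Hypotheses (l_sorted : sorted geq l) (l_uniq : uniq l).
Hypothesis l_gt0 : forall x, x \in l -> (0 < x)%N.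

Lemma sorted_geq_head x : x \in l -> (x <= nth 0 l 0)%N.
Proof.
case: l l_sorted => //= a l' sl'; rewrite inE => /predU1P[-> //|xl'].
have geq_trans : transitive geq by move=> y z w /= h1 h2;
  exact: leq_trans h2 h1.
by have /allP/(_ x xl') := order_path_min geq_trans sl'.
Qed.

(** The entries are distinct and lie between 1 and the head; if there are as many of them as the
    head says, they exhaust that interval. *)
Lemma head_size_gap_free : nth 0%N l 0 = size l -> gap_free_seq l.
Proof.
move=> l0 x y yl /andP[x0 xy].
have sub : {subset l <= iota 1 (size l)}.
  by move=> z zl; rewrite mem_iota l_gt0 //= add1n ltnS -l0 sorted_geq_head.
have [|_ ->] := uniq_min_size l_uniq sub; first by rewrite size_iota.
have := sorted_geq_head yl; rewrite l0 mem_iota; lia.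
Qed.

Lemma gap_free_nth : l != [::] -> gap_free_seq l ->
  forall j, (1 <= j <= size l)%N -> nth 0%N l j.-1 = (size l - j + 1)%N.
Proof.
move=> l_neq0 gf; have head_l : nth 0%N l 0 \in l by rewrite mem_nth // lt0n
  size_eq0.
set h := nth 0%N l 0 in head_l.
(* Both lists are decreasing with the same elements [1, ..., h]. *)
have eql : l = rev (iota 1 h).
  apply: (@sorted_eq _ geq) => //.
  - by move=> y z w /= h1 h2; exact: leq_trans h2 h1.
  - by move=> y z /= /andP[h1 h2]; apply/eqP; rewrite eqn_leq h1 h2.
  - by rewrite rev_sorted; exact: iota_sorted.
  apply: uniq_perm => // [|x]; first by rewrite rev_uniq iota_uniq.
  rewrite mem_rev mem_iota; apply/idP/idP => [xl|xh].
    by rewrite l_gt0 //= add1n ltnS sorted_geq_head.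
  by apply: gf head_l _; lia.
have size_l : size l = h by rewrite eql size_rev size_iota.
by move=> j lt_j; rewrite {1}eql nth_rev size_iota ?nth_iota; lia.
Qed.

End GapFreeLists.

Section JordanSizes.

Variables (R : fieldType) (bs : seq (R * nat)).

Lemma mem_jordan_sizes c x : (x \in jordan_sizes bs c) = ((c, x) \in bs).
Proof.
rewrite mem_sort mem_undup; apply/mapP/idP => [[[c' x'] /=]|cx].
  by rewrite mem_filter => /andP[/= /eqP -> bx] ->.
by exists (c, x); rewrite // mem_filter /= eqxx.
Qed.

Lemma jordan_sizes_sorted c : sorted geq (jordan_sizes bs c).
Proof. by apply: sort_sorted => x y; exact: leq_total. Qed.

Lemma jordan_sizes_uniq c : uniq (jordan_sizes bs c).
Proof. by rewrite sort_uniq undup_uniq. Qed.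

(** Distinct pairs (eigenvalue, size) are counted eigenvalue by eigenvalue, which links the sum of
    the [s i] to the number of classes of blocks. *)
Lemma sumn_block_type : sumn [seq size l | l <- block_type bs] = size (undup
  bs).
Proof.
rewrite sumnE !big_map /=.
have sizeE c : size (jordan_sizes bs c) = (\sum_(b <- undup bs | b.1 == c) 1)%N.
  rewrite sum1_count -size_filter -(size_map snd) size_sort.
  apply/perm_size/uniq_perm => [||x]; first exact: undup_uniq.
    rewrite map_inj_in_uniq ?filter_uniq ?undup_uniq // => -[a x] [a' x'].
    by rewrite !mem_filter /= => /andP[/eqP-> _] /andP[/eqP-> _] ->.
  rewrite -(mem_sort geq) -/(jordan_sizes bs c) mem_jordan_sizes.
  apply/idP/mapP => [cx|[[c' x']]].
    by exists (c, x); rewrite // mem_filter /= eqxx mem_undup.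
  by rewrite mem_filter mem_undup /= => /andP[/eqP-> bx] ->.
under eq_bigr => c _ do rewrite sizeE.
rewrite (exchange_big_dep xpredT) //= -sum1_size; apply: eq_big_seq => b.
rewrite mem_undup => b_bs; rewrite sum1_count.
have -> : count (fun c => b.1 == c) (jordan_eigenvalues bs) =
    count_mem b.1 (jordan_eigenvalues bs).
  by apply: eq_count => c /=; rewrite eq_sym.
by rewrite count_uniq_mem ?undup_uniq // mem_undup map_f.
Qed.

End JordanSizes.

Theorem corollary4p8 (R : fieldType) (n : nat) (c : 'M[R]_n.+1)
  (t : nat) (s : 'I_t -> nat) (lambda : 'I_t -> nat -> nat)
  (hc : jordan_similar_of_type c
          [seq [seq lambda i j | j <- iota 1 (s i)] | i <- enum 'I_t]) :
  number_of_simple_modules (centralizer_alg c) (\sum_(i < t) s i)%N /\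
  (quasi_hereditary (centralizer_alg c) <->
   forall (i : 'I_t) (j : nat), (1 <= j <= s i)%N ->
     lambda i j = (s i - j + 1)%N) /\
  ((forall (i : 'I_t) (j : nat), (1 <= j <= s i)%N ->
     lambda i j = (s i - j + 1)%N) <->
   (forall i : 'I_t, lambda i 1%N = s i)).
Proof.
have [bs [u [u_unit [/allP bs_gt0 [e uc]] lam_bs]]] := hc.
pose r (k : 'I_(size bs)) := (tnth (in_tuple bs) k).1.
pose m (k : 'I_(size bs)) := (tnth (in_tuple bs) k).2.
pose U : 'M[R]_(\sum_k m k, n.+1) := castmx (esym e, erefl) u.
pose V : 'M[R]_(n.+1, \sum_k m k) := castmx (erefl, esym e) (invmx u).
have UV : U *m V = 1%:M.
  by have := conj_castmx e u 1%:M (invmx u); rewrite !mulmx1 mulmxV // castmx1.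
have VU : V *m U = 1%:M by rewrite castmx_mulVK mulVmx.
have UcV : U *m c *m V = \mxdiag_k jordan_block (m k) (r k).
  by rewrite conj_castmx uc castmx_comp /= castmx_id.
have bA := centralizer_block_algebra UV VU UcV.
have m_gt0 k : (0 < m k)%N by apply: bs_gt0; exact: mem_tnth.
have rm_bs : [seq (r k, m k) | k : 'I_(size bs)] = bs.
  apply: etrans (map_tnth_enum (in_tuple bs)).
  by apply: eq_map => k; rewrite -surjective_pairing.
have mem_bs a x : reflect (exists k, r k = a /\ m k = x) ((a, x) \in bs).
  apply: (iffP idP) => [|[k [<- <-]]]; last first.
    by rewrite -surjective_pairing; exact: (mem_tnth k (in_tuple bs)).
  by rewrite -{1}rm_bs => /mapP[k _ [-> ->]]; exists k.
set lam := map _ _ in lam_bs.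
pose li i := [seq lambda i j | j <- iota 1 (s i)].
have li_size i : size (li i) = s i by rewrite size_map size_iota.
have li_nth i j : (1 <= j <= s i)%N -> nth 0%N (li i) j.-1 = lambda i j.
  by move=> ij; rewrite (nth_map 0%N) ?size_iota ?nth_iota; [congr lambda|..];
    lia.
(* The permutation of tuples is used only through membership: each tuple belongs to some eigenvalue,
   and each eigenvalue has some tuple. *)
have liP i : exists2 a, a \in jordan_eigenvalues bs & li i = jordan_sizes bs a.
  have : li i \in block_type bs by rewrite -(perm_mem lam_bs) map_f ?mem_enum.
  by case/mapP=> a ea ->; exists a.
have eigP a : a \in jordan_eigenvalues bs -> exists i, li i = jordan_sizes bs a.
  move=> ea; have : jordan_sizes bs a \in lam by rewrite (perm_mem lam_bs)
    map_f.
  by case/mapP=> i _ ->; exists i.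
have sizes_gt0 a x : x \in jordan_sizes bs a -> (0 < x)%N.
  by rewrite mem_jordan_sizes => /bs_gt0.
have sizes_neq0 a : a \in jordan_eigenvalues bs -> jordan_sizes bs a != [::].
  rewrite mem_undup => /mapP[[a' x] bx /= ->].
  by apply/eqP => E; have := mem_jordan_sizes bs a' x; rewrite E bx.
(* Every eigenvalue has a block, so [j = 1] is in range in (b), as (c) requires. *)
have li_gt0 i : (0 < s i)%N.
  by have [a /sizes_neq0 a0 Ei] := liP i; rewrite -li_size Ei lt0n size_eq0.
split.
  have -> : (\sum_(i < t) s i)%N = size (undup [seq (r k, m k) | k : 'I_(size
    bs)]).
    have lam_size : [seq size l | l <- lam] = [seq s i | i <- enum 'I_t].
      by rewrite -map_comp; apply: eq_map => i; exact: li_size.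
    rewrite rm_bs -sumn_block_type -(perm_sumn (perm_map size lam_bs)) lam_size.
    by rewrite sumnE big_map big_enum.
  exact (block_number_of_simple_modules bA m_gt0).
have b_c : (forall i j, (1 <= j <= s i)%N -> lambda i j = (s i - j + 1)%N) ->
    forall i, lambda i 1%N = s i.
  by move=> b i; rewrite b ?li_gt0 //; have := li_gt0 i; lia.
have c_gf : (forall i, lambda i 1%N = s i) -> forall i, gap_free_seq (li i).
  move=> lam1 i; have [a ea Ei] := liP i.
  have : nth 0%N (li i) 0 = size (li i) by rewrite li_size (li_nth i 1%N)
    ?li_gt0.
  rewrite Ei; apply: head_size_gap_free => [||x /sizes_gt0//].
    exact: jordan_sizes_sorted.
  exact: jordan_sizes_uniq.
have gf_b : (forall i, gap_free_seq (li i)) ->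
    forall i j, (1 <= j <= s i)%N -> lambda i j = (s i - j + 1)%N.
  move=> gf i j ij; have [a ea Ei] := liP i; rewrite -li_nth // -li_size.
  have := gf i; rewrite -li_size in ij; rewrite Ei in ij *.
  move=> gfa; apply: gap_free_nth gfa _ ij => [||x /sizes_gt0//|].
  - exact: jordan_sizes_sorted.
  - exact: jordan_sizes_uniq.
  - exact: sizes_neq0.
(* Absence of gaps links the three conditions: it is equivalent to (a), it implies (b), (b) implies
   (c), and (c) implies it. *)
have qh_gf : quasi_hereditary (centralizer_alg c) <-> forall i, gap_free_seq
  (li i).
  split=> [/(quasi_hereditary_gap_free bA) gf i x y|gf].
    have [a ea ->] := liP i;
      rewrite !mem_jordan_sizes => /mem_bs[k [<- <-]] /gf[l rml].
    by apply/mem_bs; exists l.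
  apply: (gap_free_quasi_hereditary bA) => k x x_le.
  have bk : (r k, m k) \in bs by apply/mem_bs; exists k.
  have ek : r k \in jordan_eigenvalues bs by rewrite mem_undup; apply/mapP;
    exists (r k, m k).
  have [i Ei] := eigP _ ek; have := gf i x (m k).
  by rewrite Ei !mem_jordan_sizes => /(_ bk x_le)/mem_bs.
by split; split; auto => ?; [apply: gf_b; apply/qh_gf|apply/qh_gf; auto].
Qed.
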